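(* There is a polynomial-time algorithm that, given a finite set $\mathcal{C}$ of alternatives, an alternative $c\in\mathcal{C}$ and a profile $P_{poset}$ of partial orders on $\mathcal{C}$, checks whether or not $c$ is a necessary unique winner for $P_{poset}$ with respect to plurality with runoff.
   Context: Let $\mathcal{C}$ be a finite set of $m$ alternatives; $m$ is part of the input and not bounded, and votes are unweighted. A (complete) profile is a finite list $P=(V_1,\dots,V_n)$ of linear orders on $\mathcal{C}$. A voting rule $r$ maps each profile to a nonempty subset of $\mathcal{C}$ (the winners). A partial order is a reflexive, transitive, antisymmetric relation; a linear order $V$ extends a partial order $O$ if $O\subseteq V$. A profile $P=(V_1,\dots,V_n)$ of linear orders extends a profile $P_{poset}=(O_1,\dots,O_n)$ of partial orders if each $V_i$ extends $O_i$. An alternative $c$ is a necessary (unique) winner for $P_{poset}$ with respect to $r$ if every extension $P$ of $P_{poset}$ satisfies $r(P)=\{c\}$. Plurality with runoff has two steps. In the first step, all alternatives are eliminated except the two that are ranked in the top position most often; in the second step (the runoff), the one of these two that is preferred to the other by a majority of the votes wins. Parallel-universes tie-breaking is used: an alternative is a winner if and only if there exists a way to break ties in both steps (the choice of the two alternatives entering the runoff, and the runoff itself) such that it wins. *)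

(* Defs.v *)
(* Mathematical Components *)
From mathcomp Require Import all_boot all_order all_algebra.

Set Implicit Arguments.
Unset Strict Implicit.
Unset Printing Implicit Defensive.

(** * Voting with partial orders *)

Section Voting.
Variable C : finType.

(* A binary relation on C as a set of ordered pairs; (a, b) \in R reads
   "a is ranked at least as high as b". *)
Definition relation : Type := {set C * C}.

Definition is_partial_order (R : relation) : Prop :=
  [/\ forall a, (a, a) \in R,
      forall a b, (a, b) \in R -> (b, a) \in R -> a = b
    & forall a b c, (a, b) \in R -> (b, c) \in R -> (a, c) \in R].

Definition is_linear_order (R : relation) : Prop :=
  is_partial_order R /\ forall a b, (a, b) \in R \/ (b, a) \in R.

Definition partial_profile (P : seq relation) : Prop :=
  forall R, R \in P -> is_partial_order R.

Definition complete_profile (P : seq relation) : Prop :=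
  forall R, R \in P -> is_linear_order R.

(* [all2] also forces the two profiles to have the same number of votes. *)
Definition extends (P Pposet : seq relation) : Prop :=
  all2 (fun O V : relation => O \subset V) Pposet P.

Definition necessary_unique_winner (r : seq relation -> {set C})
    (Pposet : seq relation) (c : C) : Prop :=
  forall P, complete_profile P -> extends P Pposet -> r P = [set c].

Definition top_count (P : seq relation) (a : C) : nat :=
  count (fun V : relation => [forall b, (a, b) \in V]) P.

Definition pref_count (P : seq relation) (a b : C) : nat :=
  count (fun V : relation => (a, b) \in V) P.

(* S can enter the runoff for some way of breaking ties in the first step.
   With a single alternative nobody is eliminated. *)
Definition finalists (P : seq relation) (S : {set C}) : bool :=
  (#|S| == minn 2 #|C|) &&
  [forall a in S, forall b in ~: S, top_count P b <= top_count P a].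

(* c can win the runoff among S for some way of breaking ties in it. *)
Definition runoff_winner (P : seq relation) (S : {set C}) (c : C) : bool :=
  (c \in S) &&
  [forall d in S, (d != c) ==> (pref_count P d c <= pref_count P c d)].

Definition plurality_runoff (P : seq relation) : {set C} :=
  [set c | [exists S : {set C}, finalists P S && runoff_winner P S c]].

End Voting.

(** * Polynomial time *)

(* The model of computation is Jones' WHILE language: imperative programs over
   binary trees ("Computability and Complexity from a Programming
   Perspective", 1997). Instead of his unit cost, every evaluation of an
   expression, subexpressions included, is charged the size of its value.
   This is a logarithmic-cost measure: a value is paid for symbol by symbol
   each time it is produced or copied, so that a multi-tape Turing machine
   storing the variables as words simulates a program with polynomial
   overhead, and conversely. *)

Inductive tree : Type := Leaf | Node of tree & tree.

Fixpoint tree_size (t : tree) : nat :=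
  if t is Node l r then (tree_size l + tree_size r).+1 else 1.

Inductive expr : Type :=
| EVar of nat
| ELeaf
| ENode of expr & expr
| ELeft of expr
| ERight of expr.

Inductive cmd : Type :=
| CSkip
| CAssign of nat & expr
| CSeq of cmd & cmd
| CIf of expr & cmd & cmd
| CWhile of expr & cmd.

Definition store : Type := nat -> tree.

Definition update (s : store) (x : nat) (t : tree) : store :=
  fun y => if y == x then t else s y.

Fixpoint eval (s : store) (e : expr) : tree :=
  match e with
  | EVar x => s x
  | ELeaf => Leaf
  | ENode e1 e2 => Node (eval s e1) (eval s e2)
  | ELeft e1 => if eval s e1 is Node l _ then l else Leaf
  | ERight e1 => if eval s e1 is Node _ r then r else Leaf
  end.

Fixpoint eval_cost (s : store) (e : expr) : nat :=
  tree_size (eval s e) +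
  match e with
  | EVar _ | ELeaf => 0
  | ENode e1 e2 => eval_cost s e1 + eval_cost s e2
  | ELeft e1 | ERight e1 => eval_cost s e1
  end.

(* Leaf is false, every other tree is true. *)
Definition truth (t : tree) : bool := if t is Leaf then false else true.

(* [exec p s t s']: started in store s, p halts in store s' after time t. *)
Inductive exec : cmd -> store -> nat -> store -> Prop :=
| exec_skip s : exec CSkip s 1 s
| exec_assign s x e :
    exec (CAssign x e) s (eval_cost s e).+1 (update s x (eval s e))
| exec_seq p1 p2 s t1 s1 t2 s2 :
    exec p1 s t1 s1 -> exec p2 s1 t2 s2 ->
    exec (CSeq p1 p2) s (t1 + t2) s2
| exec_if e p1 p2 s t s' :
    exec (if truth (eval s e) then p1 else p2) s t s' ->
    exec (CIf e p1 p2) s (eval_cost s e + t).+1 s'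
| exec_while_false e p s :
    ~~ truth (eval s e) -> exec (CWhile e p) s (eval_cost s e).+1 s
| exec_while_true e p s t1 s1 t2 s2 :
    truth (eval s e) -> exec p s t1 s1 -> exec (CWhile e p) s1 t2 s2 ->
    exec (CWhile e p) s (eval_cost s e + t1 + t2).+1 s2.

(* Variable 0 holds the input, and the output at the end of the run. *)
Definition init_store (input : tree) : store := update (fun=> Leaf) 0 input.

Definition enc_bool (b : bool) : tree := if b then Node Leaf Leaf else Leaf.

Definition enc_seq (T : Type) (enc : T -> tree) (s : seq T) : tree :=
  foldr (fun x t => Node (enc x) t) Leaf s.

Definition polytime_decidable (I : Type) (enc : I -> tree) (L : I -> Prop) :
    Prop :=
  exists (prog : cmd) (p : {poly nat}), forall x : I,
  exists (t : nat) (s : store) (b : bool),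
    [/\ exec prog (init_store (enc x)) t s,
        t <= (p.[tree_size (enc x)])%R,
        s 0 = enc_bool b
      & b <-> L x].

(** * Instances of the necessary winner problem *)

Record instance : Type := Instance {
  alternatives : finType;
  candidate : alternatives;
  votes : seq (relation alternatives);
  votesP : partial_profile votes
}.

(* A partial order is given by its Boolean matrix and the candidate by its
   indicator vector, both along [enum] of the set of alternatives. *)
Definition enc_relation (C : finType) (R : relation C) : tree :=
  enc_seq (fun a => enc_seq (fun b => enc_bool ((a, b) \in R)) (enum C))
    (enum C).

Definition enc_instance (x : instance) : tree :=
  Node (enc_seq (fun a => enc_bool (a == candidate x)) (enum (alternatives x)))
       (enc_seq (@enc_relation (alternatives x)) (votes x)).

(* Main.v *)
Require Import Defs.
From mathcomp Require Import all_boot all_order all_algebra.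
From mathcomp Require Import zify.

(** The candidate c fails exactly when there are distinct d <> c and e such that
    in some extension d and e both reach the runoff and d does not lose to e.
    Which extensions exist is a matter of choosing, in each vote, an undominated
    alternative to put first: if it is not e, then d can moreover be put above e
    unless the vote already says otherwise. Votes where d can be first go to d
    or e, votes where e is undominated and already above d go to e, and placing
    the remaining votes so that no other alternative exceeds T first places and
    e receives at most K of them is a bipartite matching problem between votes
    and slots (a, k). That d and e can then be brought to T first places without
    making e the runoff winner is a matter of counting.

    Matchings are found by an auction: an unmatched vote takes a cheapest
    admissible slot, whose price goes up by one. If all slots admissible for some
    vote become too expensive, then some price level is skipped, and the slots
    above it together with their holders violate Hall's condition.

    Running times are obtained from a class of functions between encodable types
    that is closed under composition, pairing, tests and folds whose accumulator
    stays polynomially bounded. *)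

Set Implicit Arguments.
Unset Strict Implicit.
Unset Printing Implicit Defensive.

(** * Polynomial-time functions *)

(** Bundling a type with its encoding lets the encoding of a composite type be inferred in the
    closure lemmas. *)
Structure encType := EncType { enc_sort :> Type; enc : enc_sort -> tree }.

Canonical bool_encType := EncType enc_bool.
(** Unary notation is affordable because every number that occurs, be it a count, an index or a
    price, is polynomial in the size of the input. *)
Definition enc_nat (n : nat) : tree := iter n (Node Leaf) Leaf.
Canonical nat_encType := EncType enc_nat.
Canonical prod_encType (A B : encType) :=
  @EncType (A * B) (fun p => Node (enc p.1) (enc p.2)).
Canonical seq_encType (A : encType) := EncType (enc_seq (@enc A)).
Canonical tree_encType := EncType (fun t : tree => t).
Canonical instance_encType := EncType enc_instance.

Definition esize (A : encType) (x : A) : nat := tree_size (enc x).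

Lemma tree_size_gt0 t : 0 < tree_size t. Proof. by case: t. Qed.

Lemma esize_gt0 (A : encType) (x : A) : 0 < esize x.
Proof. exact: tree_size_gt0. Qed.

Lemma esize_pair (A B : encType) (x : A) (y : B) :
  esize (x, y) = (esize x + esize y).+1.
Proof. by []. Qed.

Lemma enc_cons (A : encType) (a : A) (l : seq A) :
  enc (a :: l) = Node (enc a) (enc l).
Proof. by []. Qed.

Lemma esize_cons (A : encType) (a : A) (l : seq A) :
  esize (a :: l) = (esize a + esize l).+1.
Proof. by []. Qed.

Lemma esize_cat (A : encType) (l1 l2 : seq A) :
  (esize (l1 ++ l2)).+1 = esize l1 + esize l2.
Proof. by elim: l1 => [|a l IH] //; rewrite cat_cons !esize_cons; lia. Qed.

Lemma esize_nat (n : nat) : esize n = n.*2.+1.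
Proof. by elim: n => // n; rewrite /esize /= => ->; lia. Qed.

Lemma esize_size (A : encType) (l : seq A) : size l < esize l.
Proof. by elim: l => [|a l IH] //; rewrite esize_cons /=; lia. Qed.

Lemma esize_mem (A : encType) (l1 l2 : seq A) a :
  esize a < esize (l1 ++ a :: l2).
Proof.
have := esize_cat l1 (a :: l2); rewrite esize_cons.
have := esize_gt0 l1; have := esize_gt0 l2; lia.
Qed.

(** * Polynomial bounds in the size of the encoding *)

Definition poly_bounded (A : encType) (g : A -> nat) : Prop :=
  exists k, forall x, g x <= (esize x).+1 ^ k.

Lemma poly_bounded_le (A : encType) (g h : A -> nat) :
  (forall x, g x <= h x) -> poly_bounded h -> poly_bounded g.
Proof. by move=> gh [k hk]; exists k => x; apply: leq_trans (gh x) (hk x). Qed.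

Lemma poly_bounded_const (A : encType) c : poly_bounded (fun _ : A => c).
Proof.
exists c => x; apply: leq_trans (ltnW (ltn_expl c (ltnSn 1))) _.
by case: c => // c; rewrite leq_exp2r // ltnS esize_gt0.
Qed.

Lemma poly_bounded_esize (A : encType) : poly_bounded (@esize A).
Proof. by exists 1 => x; rewrite expn1. Qed.

Lemma poly_bounded_mul (A : encType) (g h : A -> nat) :
  poly_bounded g -> poly_bounded h -> poly_bounded (fun x => g x * h x).
Proof.
by move=> [k gk] [l hl]; exists (k + l) => x; rewrite expnD leq_mul.
Qed.

Lemma poly_bounded_add (A : encType) (g h : A -> nat) :
  poly_bounded g -> poly_bounded h -> poly_bounded (fun x => g x + h x).
Proof.
move=> [k gk] [l hl]; exists (maxn k l).+1 => x.
(* A size is at least 1, so the base is at least 2 and one extra factor absorbs the sum. *)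
have x1 : 1 < (esize x).+1 by rewrite ltnS esize_gt0.
apply: (@leq_trans (2 * (esize x).+1 ^ maxn k l)); last first.
  by rewrite expnS leq_mul2r x1 orbT.
rewrite mul2n -addnn leq_add //.
  by apply: leq_trans (gk x) _; rewrite leq_exp2l // leq_maxl.
by apply: leq_trans (hl x) _; rewrite leq_exp2l // leq_maxr.
Qed.

Lemma poly_bounded_comp (A B : encType) (f : A -> B) (g : B -> nat) :
  poly_bounded (fun x => esize (f x)) -> poly_bounded g ->
  poly_bounded (fun x => g (f x)).
Proof.
move=> /poly_bounded_add /(_ (poly_bounded_const A 1)) [l fl] [k gk].
exists (l * k) => x; apply: leq_trans (gk _) _; rewrite expnM.
by case: k {gk} => // k; rewrite leq_exp2r // -addn1.
Qed.

(* Registers from [N] on are preserved and only register 0 is assumed to be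
   initialised; this is what lets programs be composed. *)
Definition polytime (A B : encType) (f : A -> B) : Prop :=
  exists p N (T : A -> nat),
    [/\ poly_bounded T, poly_bounded (fun x => esize (f x))
      & forall s x, s 0 = enc x -> exists t s',
          [/\ exec p s t s', s' 0 = enc (f x),
              forall y, N <= y -> s' y = s y & t <= T x]].

Lemma polytime_esize (A B : encType) (f : A -> B) :
  polytime f -> poly_bounded (fun x => esize (f x)).
Proof. by case=> p [N [T []]]. Qed.

(** * Assignments, composition, pairing and tests *)

Lemma updateE s x t : update s x t x = t.
Proof. by rewrite /update eqxx. Qed.

Lemma update_neq s x t y : y != x -> update s x t y = s y.
Proof. by rewrite /update => /negbTE ->. Qed.

Lemma eq_polytime (A B : encType) (f g : A -> B) :
  f =1 g -> polytime f -> polytime g.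
Proof.
move=> fg [p [N [T [bT bf run]]]]; exists p, N, T; split=> //.
  by apply: poly_bounded_le bf => x; rewrite fg.
by move=> s x /run; rewrite fg.
Qed.

Lemma polytime_id (A : encType) : polytime (fun x : A => x).
Proof.
exists CSkip, 0, (fun _ => 1); split; first exact: poly_bounded_const.
  exact: poly_bounded_esize.
by move=> s x sx; exists 1, s; split=> //; apply: exec_skip.
Qed.

Lemma polytime_comp (A B D : encType) (f : A -> B) (g : B -> D) :
  polytime f -> polytime g -> polytime (fun x => g (f x)).
Proof.
move=> [p [N [T [bT bf runf]]]] [q [M [U [bU bg rung]]]].
exists (CSeq p q), (maxn N M), (fun x => T x + U (f x)); split.
- by apply: poly_bounded_add => //; apply: poly_bounded_comp bU.
- by apply: poly_bounded_comp bg.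
move=> s x /runf [t1 [s1 [e1 /rung [t2 [s2 [e2 s20 keep2 le2]]] keep1 le1]]].
exists (t1 + t2), s2; split=> //; first exact: exec_seq e1 e2.
  by move=> y; rewrite geq_max => /andP[Ny My]; rewrite keep2 // keep1.
exact: leq_add.
Qed.

Lemma polytime_assign (A B : encType) (f : A -> B) (e : expr) (T : A -> nat) :
  poly_bounded T ->
  (forall s x, s 0 = enc x -> eval s e = enc (f x) /\ eval_cost s e <= T x) ->
  polytime f.
Proof.
move=> bT he; exists (CAssign 0 e), 1, (fun x => (T x).+1); split.
- apply: poly_bounded_le (poly_bounded_add (poly_bounded_const A 1) bT) => x.
  by rewrite add1n.
(* The cost of an expression includes the size of its value, so [T] bounds the output too. *)
- apply: poly_bounded_le bT => x.
  rewrite /esize; have [<- ce] := he (fun=> enc x) x erefl.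
  by apply: leq_trans ce; case: e {he} => *; apply: leq_addr.
move=> s x /he[ee ce]; exists (eval_cost s e).+1, (update s 0 (eval s e)).
split=> //; first exact: exec_assign.
by case.
Qed.

Fixpoint const_expr (t : tree) : expr :=
  if t is Node l r then ENode (const_expr l) (const_expr r) else ELeaf.

Lemma polytime_const (A B : encType) (c : B) : polytime (fun _ : A => c).
Proof.
(* A constant expression reads no register, so its cost can be computed in any store. *)
apply: (@polytime_assign _ _ _ (const_expr (enc c))
          (fun _ => eval_cost (fun=> Leaf) (const_expr (enc c)))).
  exact: poly_bounded_const.
move=> s _ _; elim: (enc c) => //= l [-> lc] r [-> rc]; split=> //.
suff ev t : eval (fun=> Leaf) (const_expr t) = t by rewrite !ev; lia.
by elim: t {lc rc} => //= a -> b ->.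
Qed.

(** Programs see only encodings, so functions with equal encoded values share a program. Cons and
    successor thus reduce to pairing. *)
Lemma polytime_recode (G A B : encType) (f : G -> A) (g : G -> B) :
  (forall x, enc (f x) = enc (g x)) -> polytime f -> polytime g.
Proof.
move=> fg [p [N [T [bT bf run]]]]; exists p, N, T; split=> //.
  by apply: poly_bounded_le bf => x; rewrite /esize fg.
by move=> s x /run; rewrite fg.
Qed.

Definition left_subtree t := if t is Node l _ then l else Leaf.
Definition right_subtree t := if t is Node _ r then r else Leaf.

Lemma polytime_left (G A B : encType) (f : G -> A) (g : G -> B) :
  (forall x, left_subtree (enc (f x)) = enc (g x)) -> polytime f -> polytime g.
Proof.
move=> fg pf; apply: (@polytime_recode _ _ _ (fun x => left_subtree (enc (f x)))) => //.
apply: (@polytime_comp _ tree_encType _ (fun x => enc (f x))).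
  exact: polytime_recode pf.
apply: (@polytime_assign _ _ _ (ELeft (EVar 0)) (fun t => esize t + esize t)).
  by apply: poly_bounded_add; apply: poly_bounded_esize.
move=> s t /= ->; split=> //; rewrite addn0 leq_add2r.
by case: t => //= l r; rewrite /esize /=; lia.
Qed.

Lemma polytime_right (G A B : encType) (f : G -> A) (g : G -> B) :
  (forall x, right_subtree (enc (f x)) = enc (g x)) -> polytime f -> polytime g.
Proof.
move=> fg pf; apply: (@polytime_recode _ _ _ (fun x => right_subtree (enc (f x)))) => //.
apply: (@polytime_comp _ tree_encType _ (fun x => enc (f x))).
  exact: polytime_recode pf.
apply: (@polytime_assign _ _ _ (ERight (EVar 0)) (fun t => esize t + esize t)).
  by apply: poly_bounded_add; apply: poly_bounded_esize.
move=> s t /= ->; split=> //; rewrite addn0 leq_add2r.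
by case: t => //= l r; rewrite /esize /=; lia.
Qed.

Lemma polytime_fst (G A B : encType) (f : G -> A * B) :
  polytime f -> polytime (fun x => (f x).1).
Proof. exact: polytime_left. Qed.

Lemma polytime_snd (G A B : encType) (f : G -> A * B) :
  polytime f -> polytime (fun x => (f x).2).
Proof. exact: polytime_right. Qed.

Lemma polytime_pair (G A B : encType) (f : G -> A) (g : G -> B) :
  polytime f -> polytime g -> polytime (fun x => (f x, g x)).
Proof.
move=> [p [N [T [bT bf runf]]]] [q [M [U [bU bg rung]]]].
(* Both programs preserve [X] and [X.+1], which keep the input and the first result; the successor
   makes [X] differ from 0. *)
set X := (maxn N M).+1.
exists (CSeq (CAssign X (EVar 0)) (CSeq p (CSeq (CAssign X.+1 (EVar 0))
  (CSeq (CAssign 0 (EVar X)) (CSeq q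
    (CAssign 0 (ENode (EVar X.+1) (EVar 0)))))))).
exists X.+2, (fun x => esize x + T x + esize (f x) + esize x + U x
  + (esize (f x) + esize (g x)) + (esize (f x) + esize (g x)) + 5).
split.
- by repeat (apply: poly_bounded_add || exact: poly_bounded_esize
             || exact: poly_bounded_const).
- apply: poly_bounded_le (poly_bounded_add (poly_bounded_add bf bg)
    (poly_bounded_const _ 1)) => x; rewrite esize_pair; lia.
move=> s x s0.
set s1 := update s X (s 0).
have [t2 [s2 [e2 s20 keep2 le2]]] := runf s1 x s0.
set s3 := update s2 X.+1 (s2 0); set s4 := update s3 0 (s3 X).
have s40 : s4 0 = enc x.
  rewrite /s4 updateE /s3 update_neq ?neq_ltn ?leqnn // keep2; last first.
    by rewrite /X; lia.
  by rewrite /s1 updateE.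
have [t5 [s5 [e5 s50 keep5 le5]]] := rung s4 x s40.
have s5X : s5 X.+1 = enc (f x).
  rewrite keep5; last by rewrite /X; lia.
  by rewrite /s4 update_neq // /s3 updateE.
do 2! eexists; split.
- apply: (exec_seq (exec_assign _ _ _)).
  apply: (exec_seq e2); apply: (exec_seq (exec_assign _ _ _)).
  by apply: (exec_seq (exec_assign _ _ _)); apply: (exec_seq e5 (exec_assign _ _ _)).
- by rewrite updateE /= s5X s50.
- move=> y Xy; rewrite update_neq; last by lia.
  rewrite keep5; last by rewrite /X in Xy; lia.
  rewrite /s4 update_neq; last by lia.
  rewrite /s3 update_neq; last by lia.
  rewrite keep2; last by rewrite /X in Xy; lia.
  by rewrite /s1 update_neq; last by lia.
- rewrite /= -/s3 s0 s20.
  have -> : s3 X = enc x.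
    rewrite /s3 update_neq ?neq_ltn ?leqnn // keep2; last by rewrite /X; lia.
    by rewrite /s1 updateE.
  rewrite s5X s50 /esize; lia.
Qed.

Lemma polytime_if_truth (G A B : encType) (c : G -> A) (f g : G -> B) :
  polytime c -> polytime f -> polytime g ->
  polytime (fun x => if truth (enc (c x)) then f x else g x).
Proof.
move=> [o [K [S [bS bc runc]]]].
move=> [p [N [T [bT bf runf]]]] [q [M [U [bU bg rung]]]].
set X := (maxn K (maxn N M)).+1.
exists (CSeq (CAssign X (EVar 0)) (CSeq o
  (CIf (EVar 0) (CSeq (CAssign 0 (EVar X)) p) (CSeq (CAssign 0 (EVar X)) q)))).
exists X.+1, (fun x => esize x + S x + esize (c x) + esize x + T x + U x + 3).
split.
- by repeat (apply: poly_bounded_add || exact: poly_bounded_esize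
             || exact: poly_bounded_const).
- by apply: poly_bounded_le (poly_bounded_add bf bg) => x; case: ifP; lia.
move=> s x s0.
set s1 := update s X (s 0).
have [t2 [s2 [e2 s20 keep2 le2]]] := runc s1 x s0.
set s3 := update s2 0 (s2 X).
have s2X : s2 X = enc x.
  by rewrite keep2 ?/s1 ?updateE // /X; lia.
have s30 : s3 0 = enc x by rewrite /s3 updateE.
have [h] : exists t' s', [/\ exec (if truth (eval s2 (EVar 0)) then
    (CSeq (CAssign 0 (EVar X)) p) else (CSeq (CAssign 0 (EVar X)) q)) s2 t' s',
   s' 0 = enc (if truth (enc (c x)) then f x else g x),
   forall y, X < y -> s' y = s3 y & t' <= esize x + T x + U x + 1].
  rewrite /= s20; case: ifP => _.
    have [t [s' [e' s'0 keep' le']]] := runf s3 x s30.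
    do 2! eexists; split; [by apply: (exec_seq (exec_assign _ _ _)); exact: e'|by []| |].
      by move=> y Xy; rewrite keep' //; rewrite /X in Xy; lia.
    rewrite /= s2X /esize; lia.
  have [t [s' [e' s'0 keep' le']]] := rung s3 x s30.
  do 2! eexists; split; [by apply: (exec_seq (exec_assign _ _ _)); exact: e'|by []| |].
    by move=> y Xy; rewrite keep' //; rewrite /X in Xy; lia.
  rewrite /= s2X /esize; lia.
move=> [s' [e' s'0 keep' le']].
do 2! eexists; split.
- apply: (exec_seq (exec_assign _ _ _)); apply: (exec_seq e2).
  exact: exec_if e'.
- by [].
- move=> y Xy; rewrite keep' // /s3 update_neq; last by lia.
  rewrite keep2; last by rewrite /X in Xy; lia.
  by rewrite /s1 update_neq //; lia.
- rewrite /= s0 s20 /esize in le' *; lia.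
Qed.

(** * Folds over lists with a bounded accumulator *)

Section Foldl.
Variables (G A B : encType) (l : G -> seq A) (b : G -> B) (h : G -> A -> B -> B).
Variable (D : G -> nat).
Hypothesis bD : poly_bounded D.
Hypothesis accD : forall x l1 l2, l x = l1 ++ l2 ->
  esize (foldl (fun b a => h x a b) (b x) l1) <= D x.

(** Iterating a polynomial-time step can build exponentially large values, so all intermediate
    accumulators must be bounded in advance by [D]. The loop keeps the input, the remaining list and
    the accumulator in three registers beyond those used by the step. *)
Lemma polytime_foldl_bounded :
  polytime l -> polytime b ->
  polytime (fun y : G * A * B => h y.1.1 y.1.2 y.2) ->
  polytime (fun x => foldl (fun b a => h x a b) (b x) (l x)).
Proof.
move=> pl pb [q [M [U [[k bU] bg rung]]]].
have [p [N [T [bT bf runf]]]] := polytime_pair pl pb.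
have bl := polytime_esize pl.
set X := (maxn N M).+1.
pose body := CSeq (CAssign 0 (ENode (ENode (EVar X) (ELeft (EVar X.+1))) (EVar X.+2)))
  (CSeq q (CSeq (CAssign X.+2 (EVar 0)) (CAssign X.+1 (ERight (EVar X.+1))))).
pose loop := CWhile (EVar X.+1) body.
(* [Z x] dominates the size of the argument of [q], [Z x ^ k] the run of [q], and [W x] the cost of
   a whole round, whose test and assignments are covered by the factor 20. *)
pose Z x := esize x + esize (l x) + D x + 4.
pose W x := 20 * Z x + Z x ^ k.
have bZ : poly_bounded Z.
  by repeat (apply: poly_bounded_add || exact: poly_bounded_esize
             || exact: poly_bounded_const).
have bW : poly_bounded W.
  apply: poly_bounded_add.
    by apply: poly_bounded_mul => //; apply: poly_bounded_const.
  elim: (k) => [|j IH]; first exact: (poly_bounded_const _ 1).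
  by apply: poly_bounded_le (poly_bounded_mul bZ IH) => x; rewrite expnS.
(* Invariant of the loop: [l1] has been folded and [l2] remains. *)
have loopP x l1 l2 s : l x = l1 ++ l2 -> s X = enc x -> s X.+1 = enc l2 ->
    s X.+2 = enc (foldl (fun b a => h x a b) (b x) l1) ->
    exists t s', [/\ exec loop s t s',
      s' X.+2 = enc (foldl (fun b a => h x a b) (b x) (l x)),
      forall y, X.+2 < y -> s' y = s y & t <= (size l2).+1 * W x].
  elim: l2 l1 s => [|a l2 IH] l1 s lx sX sX1 sX2.
    do 2! eexists; split.
    - by apply: exec_while_false; rewrite /= sX1.
    - by rewrite sX2 lx cats0.
    - by [].
    - by rewrite /= sX1 /W /Z /=; lia.
  set v := foldl _ _ _ in sX2.
  set s1 := update s 0 (Node (Node (enc x) (enc a)) (enc v)).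
  have [t2 [s2 [e2 s20 keep2 le2]]] := rung s1 (x, a, v) erefl.
  rewrite /= in s20.
  set s3 := update s2 X.+2 (s2 0).
  set s4 := update s3 X.+1 (enc l2).
  have lx' : l x = rcons l1 a ++ l2 by rewrite cat_rcons.
  have s2E y : X <= y -> s2 y = s y.
    move=> Xy; rewrite keep2; last by rewrite /X in Xy; lia.
    by rewrite /s1 update_neq //; rewrite /X in Xy; lia.
  have [t5 [s5 [e5 s50 keep5 le5]]] : exists t s', [/\ exec loop s4 t s',
      s' X.+2 = enc (foldl (fun b a => h x a b) (b x) (l x)),
      forall y, X.+2 < y -> s' y = s4 y & t <= (size l2).+1 * W x].
    apply: IH lx' _ _ _.
    - rewrite /s4 update_neq ?/s3 ?update_neq ?s2E //; lia.
    - by rewrite /s4 updateE.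
    - rewrite /s4 update_neq ?/s3 ?updateE ?s20; last by lia.
      by rewrite foldl_rcons.
  have evs : eval s (ENode (ENode (EVar X) (ELeft (EVar X.+1))) (EVar X.+2)) =
      Node (Node (enc x) (enc a)) (enc v) by rewrite /= sX sX1 sX2.
  have evs3 : eval s3 (ERight (EVar X.+1)) = enc l2.
    rewrite /= /s3 update_neq ?s2E ?sX1 //; lia.
  do 2! eexists; split.
  - apply: exec_while_true; [by rewrite /= sX1| |exact: e5].
    apply: (exec_seq (exec_assign _ _ _)); rewrite evs.
    apply: (exec_seq e2); apply: (exec_seq (exec_assign _ _ _)).
    by rewrite /s4 -evs3; apply: exec_assign.
  - by [].
  - move=> y Xy; rewrite keep5 // /s4 update_neq; last by lia.
    by rewrite /s3 update_neq ?s2E //; lia.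
  - have le_v : esize v <= D x by apply: accD lx.
    have le_v' : esize (h x a v) <= D x.
      by have := accD lx'; rewrite foldl_rcons.
    have : esize (a :: l2) <= esize (l x).
      by rewrite lx; have := esize_cat l1 (a :: l2); have := esize_gt0 l1; lia.
    rewrite esize_cons => le_a.
    have : t2 <= Z x ^ k.
      apply: leq_trans le2 _; apply: leq_trans (bU _) _.
      case: (k) => // j; rewrite leq_exp2r // !esize_pair /Z; lia.
    have s3X : s3 X.+1 = enc (a :: l2).
      rewrite /s3 update_neq ?s2E ?sX1 //; lia.
    rewrite /= -?/s3 s3X s20 sX sX1 sX2 enc_cons /= => le_t2.
    move: le5 le_v le_v' le_a le_t2; rewrite [_.+2 * _]mulSn.
    by move: (_.+1 * W x) => w; rewrite /W /Z /esize /=; lia.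
exists (CSeq (CAssign X (EVar 0)) (CSeq p (CSeq (CAssign X.+1 (ELeft (EVar 0)))
  (CSeq (CAssign X.+2 (ERight (EVar 0))) (CSeq loop (CAssign 0 (EVar X.+2))))))).
exists X.+3, (fun x => T x + (esize (l x)).+1 * W x + 10 * Z x).
split.
- apply: poly_bounded_add; first apply: poly_bounded_add => //.
    apply: poly_bounded_mul => //.
    by apply: poly_bounded_le (poly_bounded_add bl (poly_bounded_const _ 1)) => x; lia.
  by apply: poly_bounded_mul => //; apply: poly_bounded_const.
- by apply: poly_bounded_le bD => x; apply: (accD (l2 := [::])); rewrite cats0.
move=> s x s0.
set s1 := update s X (s 0).
have [t2 [s2 [e2 s20 keep2 le2]]] := runf s1 x s0.
set s3 := update s2 X.+1 (enc (l x)).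
set s4 := update s3 X.+2 (enc (b x)).
have s2X : s2 X = enc x.
  by rewrite keep2 ?/s1 ?updateE // /X; lia.
have [t5 [s5 [e5 s50 keep5 le5]]] : exists t s', [/\ exec loop s4 t s',
      s' X.+2 = enc (foldl (fun b a => h x a b) (b x) (l x)),
      forall y, X.+2 < y -> s' y = s4 y & t <= (size (l x)).+1 * W x].
  apply: (@loopP x [::]) => //.
  - rewrite /s4 update_neq ?/s3 ?update_neq //; lia.
  - rewrite /s4 update_neq ?/s3 ?updateE //; lia.
  - by rewrite /s4 updateE.
have ev3 : eval s2 (ELeft (EVar 0)) = enc (l x) by rewrite /= s20.
have ev4 : eval s3 (ERight (EVar 0)) = enc (b x).
  by rewrite /= /s3 update_neq // s20.
do 2! eexists; split.
- apply: (exec_seq (exec_assign _ _ _)); apply: (exec_seq e2).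
  apply: (exec_seq (exec_assign _ _ _)); rewrite ev3 -/s3.
  apply: (exec_seq (exec_assign _ _ _)); rewrite ev4 -/s4.
  exact: exec_seq e5 (exec_assign _ _ _).
- by rewrite updateE /= s50.
- move=> y Xy; rewrite update_neq; last by lia.
  rewrite keep5 // /s4 update_neq; last by lia.
  rewrite /s3 update_neq; last by lia.
  rewrite keep2; last by rewrite /X in Xy; lia.
  by rewrite /s1 update_neq //; lia.
have le_b : esize (b x) <= D x by apply: (accD (l1 := [::]) (l2 := l x)).
have le_r : esize (foldl (fun b a => h x a b) (b x) (l x)) <= D x.
  by apply: (accD (l2 := [::])); rewrite cats0.
have s30 : s3 0 = enc (l x, b x) by rewrite /s3 update_neq.
have := esize_size (l x).
rewrite /= s0 s50 s20 s30 /= -!/(esize _) => le_l.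
have : (size (l x)).+1 * W x <= (esize (l x)).+1 * W x.
  by rewrite leq_mul2r ltnS ltnW ?orbT.
move: le5 le_b le_r le2; rewrite /Z /esize /=.
move: (_ * W x) => w; move: (_ * W x) => w'. lia.
Qed.

End Foldl.

(** When each step adds to the accumulator an amount independent of it, the total growth is at most
    the number of steps times a polynomial, which provides the bound on intermediate
    accumulators. *)
Lemma polytime_foldl (G A B : encType) (l : G -> seq A) (b : G -> B)
    (h : G -> A -> B -> B) (E : G * A -> nat) :
  poly_bounded E ->
  (forall x a b, esize (h x a b) <= esize b + E (x, a)) ->
  polytime l -> polytime b ->
  polytime (fun y : G * A * B => h y.1.1 y.1.2 y.2) ->
  polytime (fun x => foldl (fun b a => h x a b) (b x) (l x)).
Proof.
move=> [k bE] hE pl pb ph.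
have bl := polytime_esize pl; have bb := polytime_esize pb.
pose F x := (esize x + esize (l x) + 2) ^ k.
have bF : poly_bounded F.
  rewrite /F; elim: (k) => [|j IH]; first exact: (poly_bounded_const _ 1).
  apply: (@poly_bounded_le _ _ (fun x => (esize x + esize (l x) + 2)
      * (esize x + esize (l x) + 2) ^ j)); first by move=> x; rewrite expnS.
  apply: poly_bounded_mul => //; apply: poly_bounded_add; last first.
    exact: poly_bounded_const.
  by apply: poly_bounded_add => //; apply: poly_bounded_esize.
apply: (@polytime_foldl_bounded _ _ _ _ _ _
  (fun x => esize (b x) + esize (l x) * F x)) => //.
  by apply: poly_bounded_add => //; apply: poly_bounded_mul.
move=> x l1 l2 lx.
suff: esize (foldl (fun b a => h x a b) (b x) l1) <= esize (b x) + size l1 * F x.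
  move/leq_trans; apply; rewrite leq_add2l leq_mul2r.
  by apply/orP; right; have := esize_size (l x); rewrite lx size_cat; lia.
elim/last_ind: l1 l2 lx => [|l1 a IH] l2 lx; first by rewrite addn0.
rewrite foldl_rcons; apply: leq_trans (hE _ _ _) _.
rewrite size_rcons mulSn addnCA addnC leq_add //; last first.
  by apply: IH (a :: l2) _; rewrite lx cat_rcons.
apply: leq_trans (bE _) _; rewrite /F.
case: (k) => // j; rewrite leq_exp2r // esize_pair.
by rewrite lx cat_rcons; have := esize_mem l1 l2 a; lia.
Qed.

(** * Boolean, list and arithmetic operations *)

Lemma polytime_if (G B : encType) (c : G -> bool) (f g : G -> B) :
  polytime c -> polytime f -> polytime g ->
  polytime (fun x => if c x then f x else g x).
Proof.
move=> pc pf pg; apply: eq_polytime (polytime_if_truth pc pf pg) => x.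
by rewrite /=; case: (c x).
Qed.

Lemma polytime_negb (G : encType) (c : G -> bool) :
  polytime c -> polytime (fun x => ~~ c x).
Proof.
move=> pc; apply: eq_polytime (polytime_if pc (polytime_const _ false)
  (polytime_const _ true)) => x; by case: (c x).
Qed.

Lemma polytime_andb (G : encType) (c d : G -> bool) :
  polytime c -> polytime d -> polytime (fun x => c x && d x).
Proof. by move=> pc pd; apply: polytime_if pc pd (polytime_const _ false). Qed.

Lemma polytime_orb (G : encType) (c d : G -> bool) :
  polytime c -> polytime d -> polytime (fun x => c x || d x).
Proof. by move=> pc pd; apply: polytime_if pc (polytime_const _ true) pd. Qed.

Lemma polytime_implb (G : encType) (c d : G -> bool) :
  polytime c -> polytime d -> polytime (fun x => c x ==> d x).
Proof. by move=> pc pd; apply: polytime_if pc pd (polytime_const _ true). Qed.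

Lemma polytime_nilp (G A : encType) (l : G -> seq A) :
  polytime l -> polytime (fun x => nilp (l x)).
Proof.
move=> pl; apply: eq_polytime (polytime_if_truth pl (polytime_const _ false)
  (polytime_const _ true)) => x; by case: (l x).
Qed.

Lemma polytime_cons (G A : encType) (a : G -> A) (l : G -> seq A) :
  polytime a -> polytime l -> polytime (fun x => a x :: l x).
Proof. by move=> pa pl; apply: polytime_recode (polytime_pair pa pl). Qed.

Lemma polytime_head (G A : encType) (a : A) (l : G -> seq A) :
  polytime l -> polytime (fun x => head a (l x)).
Proof.
move=> pl; apply: (@polytime_recode _ tree_encType _
  (fun x => if truth (enc (l x)) then left_subtree (enc (l x)) else enc a)).
  by move=> x; case: (l x).
apply: polytime_if_truth => //; first exact: polytime_left pl.
exact: polytime_const.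
Qed.

Lemma polytime_behead (G A : encType) (l : G -> seq A) :
  polytime l -> polytime (fun x => behead (l x)).
Proof. by apply: polytime_right => x; case: (l x). Qed.

Lemma polytime_succn (G : encType) (n : G -> nat) :
  polytime n -> polytime (fun x => (n x).+1).
Proof.
move=> pn; apply: polytime_recode (polytime_pair (polytime_const _ Leaf) pn).
by [].
Qed.

Lemma polytime_predn (G : encType) (n : G -> nat) :
  polytime n -> polytime (fun x => (n x).-1).
Proof. by apply: polytime_right => x; case: (n x). Qed.

Lemma polytime_catrev (G A : encType) (l r : G -> seq A) :
  polytime l -> polytime r -> polytime (fun x => catrev (l x) (r x)).
Proof.
move=> pl pr; apply: (@eq_polytime _ _
  (fun x => foldl (fun s a => a :: s) (r x) (l x))) => [x|].
  by elim: (l x) (r x) => //= a s IH t; rewrite IH.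
apply: (@polytime_foldl _ _ _ _ _ (fun _ a s => a :: s)
  (fun p => (esize p.2).+1)) => //.
- by exists 1 => -[x a]; rewrite esize_pair expn1 /=; lia.
- by move=> x a b; rewrite esize_cons /=; lia.
- apply: polytime_cons; last exact/polytime_snd/polytime_id.
  exact/polytime_snd/polytime_fst/polytime_id.
Qed.

Lemma polytime_rev (G A : encType) (l : G -> seq A) :
  polytime l -> polytime (fun x => rev (l x)).
Proof. by move=> pl; apply: polytime_catrev pl (polytime_const _ _). Qed.

Lemma polytime_cat (G A : encType) (l r : G -> seq A) :
  polytime l -> polytime r -> polytime (fun x => l x ++ r x).
Proof.
move=> /polytime_rev pl pr.
apply: eq_polytime (polytime_catrev pl pr) => x.
by rewrite catrevE revK.
Qed.

Lemma polytime_map (G A B : encType) (l : G -> seq A) (f : G -> A -> B) :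
  polytime l -> polytime (fun y : G * A => f y.1 y.2) ->
  polytime (fun x => [seq f x a | a <- l x]).
Proof.
move=> pl pf; have bf := polytime_esize pf.
apply: (@eq_polytime _ _
  (fun x => rev (foldl (fun s a => f x a :: s) [::] (l x)))) => [x|].
  suff h t : foldl (fun s a => f x a :: s) t (l x) =
      catrev [seq f x a | a <- l x] t by rewrite h catrevE cats0 revK.
  by elim: (l x) t => //= a s IH t; rewrite IH.
apply: polytime_rev.
apply: (@polytime_foldl _ _ _ _ _ (fun x a s => f x a :: s)
  (fun y => esize (f y.1 y.2) + 1)) => //.
- by apply: poly_bounded_add => //; apply: poly_bounded_const.
- by move=> x a b; rewrite esize_cons /=; lia.
- exact: polytime_const.
- apply: polytime_cons; last exact/polytime_snd/polytime_id.
  exact: (polytime_comp (polytime_fst (polytime_id _)) pf).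
Qed.

Lemma polytime_filter (G A : encType) (l : G -> seq A) (f : G -> A -> bool) :
  polytime l -> polytime (fun y : G * A => f y.1 y.2) ->
  polytime (fun x => [seq a <- l x | f x a]).
Proof.
move=> pl pf.
apply: (@eq_polytime _ _ (fun x => rev
  (foldl (fun s a => if f x a then a :: s else s) [::] (l x)))) => [x|].
  suff h t : foldl (fun s a => if f x a then a :: s else s) t (l x) =
      catrev [seq a <- l x | f x a] t by rewrite h catrevE cats0 revK.
  by elim: (l x) t => //= a s IH t; rewrite IH; case: ifP.
apply: polytime_rev.
apply: (@polytime_foldl _ _ _ _ _ (fun x a s => if f x a then a :: s else s)
  (fun y => esize y)) => //.
- exact: poly_bounded_esize.
- by move=> x a b; rewrite esize_pair; case: ifP; rewrite ?esize_cons /=; lia.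
- exact: polytime_const.
- apply: polytime_if; last exact/polytime_snd/polytime_id.
    exact: (polytime_comp (polytime_fst (polytime_id _)) pf).
  apply: polytime_cons; last exact/polytime_snd/polytime_id.
  exact/polytime_snd/polytime_fst/polytime_id.
Qed.

Lemma polytime_has (G A : encType) (l : G -> seq A) (f : G -> A -> bool) :
  polytime l -> polytime (fun y : G * A => f y.1 y.2) ->
  polytime (fun x => has (fun a => f x a) (l x)).
Proof.
move=> pl pf; apply: eq_polytime (polytime_negb (polytime_nilp
  (polytime_filter pl pf))) => x.
by rewrite /nilp size_filter has_count lt0n.
Qed.

Lemma polytime_all (G A : encType) (l : G -> seq A) (f : G -> A -> bool) :
  polytime l -> polytime (fun y : G * A => f y.1 y.2) ->
  polytime (fun x => all (fun a => f x a) (l x)).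
Proof.
move=> pl pf.
apply: eq_polytime (polytime_negb (polytime_has pl (f := fun x a => ~~ f x a)
  (polytime_negb pf))) => x.
by rewrite has_predC negbK.
Qed.

Lemma polytime_size (G A : encType) (l : G -> seq A) :
  polytime l -> polytime (fun x => size (l x)).
Proof.
move=> pl.
apply: (@eq_polytime _ _ (fun x => foldl (fun s _ => s.+1) 0 (l x))) => [x|].
  suff h n : foldl (fun s _ => s.+1) n (l x) = n + size (l x) by rewrite h.
  by elim: (l x) n => [|a s IH] n /=; rewrite ?addn0 // IH addSnnS.
apply: (@polytime_foldl _ _ _ _ _ (fun _ _ s => s.+1) (fun=> 2)) => //.
- exact: poly_bounded_const.
- by move=> _ _ n; rewrite !esize_nat doubleS; lia.
- exact: polytime_const.
- exact/polytime_succn/polytime_snd/polytime_id.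
Qed.

Lemma polytime_count (G A : encType) (l : G -> seq A) (f : G -> A -> bool) :
  polytime l -> polytime (fun y : G * A => f y.1 y.2) ->
  polytime (fun x => count (fun a => f x a) (l x)).
Proof.
move=> pl pf; apply: eq_polytime (polytime_size (polytime_filter pl pf)) => x.
by rewrite size_filter.
Qed.

Lemma polytime_flatten (G A : encType) (l : G -> seq (seq A)) :
  polytime l -> polytime (fun x => flatten (l x)).
Proof.
move=> pl.
apply: (@eq_polytime _ _ (fun x => foldl (fun s a => s ++ a) [::] (l x))) => [x|].
  suff h t : foldl (fun s a => s ++ a) t (l x) = t ++ flatten (l x) by rewrite h.
  by elim: (l x) t => [|a s IH] t /=; rewrite ?cats0 // IH catA.
apply: (@polytime_foldl _ _ _ _ _ (fun _ a s => s ++ a) (fun y => esize y.2)) => //.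
- by exists 1 => -[x a]; rewrite esize_pair expn1 /=; lia.
- by move=> x a s; have := esize_cat s a; rewrite /=; lia.
- exact: polytime_const.
- apply: polytime_cat; first exact/polytime_snd/polytime_id.
  exact/polytime_snd/polytime_fst/polytime_id.
Qed.

(* A unary number has the same encoding as a list of empty trees. *)
Lemma polytime_iter (G B : encType) (n : G -> nat) (b : G -> B) (h : G -> B -> B)
    (E : G -> nat) :
  poly_bounded E -> (forall x b, esize (h x b) <= esize b + E x) ->
  polytime n -> polytime b -> polytime (fun y : G * B => h y.1 y.2) ->
  polytime (fun x => iter (n x) (h x) (b x)).
Proof.
move=> bE hE pn pb ph.
apply: (@eq_polytime _ _ (fun x =>
  foldl (fun b (_ : tree) => h x b) (b x) (nseq (n x) Leaf))) => [x|].
  by elim: (n x) (b x) => //= k IH c; rewrite IH -iterSr.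
apply: (@polytime_foldl _ _ _ _ _ (fun x _ b => h x b) (fun y => E y.1)) => //.
- apply: (@poly_bounded_comp _ _ fst) bE; apply: polytime_esize.
  exact/polytime_fst/polytime_id.
- by apply: polytime_recode pn => x; elim: (n x) => //= k <-.
- apply: (polytime_comp (g := fun y : G * B => h y.1 y.2)
    (f := fun z : G * tree * B => (z.1.1, z.2))) => //.
  apply: polytime_pair; first exact/polytime_fst/polytime_fst/polytime_id.
  exact/polytime_snd/polytime_id.
Qed.

(** The length of the list built so far is the next number to push. As the growth depends on the
    accumulator, the fold is controlled by an explicit quadratic bound. *)
Lemma polytime_iota0 (G : encType) (n : G -> nat) :
  polytime n -> polytime (fun x => iota 0 (n x)).
Proof.
move=> pn.
have foldE T (l : seq T) :
    foldl (fun (s : seq nat) _ => size s :: s) [::] l = rev (iota 0 (size l)).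
  elim/last_ind: l => // l a IH; rewrite foldl_rcons IH size_rev size_iota.
  by rewrite size_rcons -addn1 iotaD rev_cat.
apply: (@eq_polytime _ _ (fun x => rev (foldl (fun s _ => size s :: s) [::]
    (nseq (n x) Leaf)))) => [x|]; first by rewrite foldE revK size_nseq.
apply: polytime_rev.
have bn := polytime_esize pn.
apply: (@polytime_foldl_bounded _ _ _ _ _ (fun _ _ s => size s :: s)
  (fun x => (esize (n x)) * (esize (n x) + 1) + 1)).
- apply: poly_bounded_add; last exact: poly_bounded_const.
  apply: poly_bounded_mul => //.
  by apply: poly_bounded_add => //; apply: poly_bounded_const.
- move=> x l1 l2 lx; rewrite foldE.
  have: size l1 <= n x.
    by rewrite -(size_nseq (n x) Leaf) lx size_cat leq_addr.
  move: (size l1) => k le_k.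
  suff: esize (rev (iota 0 k)) <= k * (n x).+1.*2 + 1.
    by rewrite esize_nat; nia.
  elim: k le_k => // k IH ltk.
  rewrite -addn1 iotaD rev_cat /= esize_cons !esize_nat.
  have := IH (ltnW ltk); rewrite /=; nia.
- by apply: polytime_recode pn => x; elim: (n x) => //= k <-.
- exact: polytime_const.
- apply: polytime_cons; last exact/polytime_snd/polytime_id.
  exact/polytime_size/polytime_snd/polytime_id.
Qed.

Lemma polytime_addn (G : encType) (m n : G -> nat) :
  polytime m -> polytime n -> polytime (fun x => m x + n x).
Proof.
move=> pm pn; apply: (@eq_polytime _ _ (fun x => iter (m x) succn (n x))).
  by move=> x; rewrite iter_succn addnC.
apply: (@polytime_iter _ _ _ _ (fun _ => succn) (fun=> 2)) => //.
- exact: poly_bounded_const.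
- by move=> _ k; rewrite !esize_nat doubleS; lia.
- exact/polytime_succn/polytime_snd/polytime_id.
Qed.

Lemma polytime_muln (G : encType) (m n : G -> nat) :
  polytime m -> polytime n -> polytime (fun x => m x * n x).
Proof.
move=> pm pn; apply: (@eq_polytime _ _ (fun x => iter (m x) (addn (n x)) 0)).
  by move=> x; rewrite iter_addn_0 mulnC.
apply: (@polytime_iter _ _ _ _ (fun x => addn (n x)) (fun x => esize (n x))) => //.
- exact: polytime_esize.
- by move=> x k; rewrite !esize_nat; lia.
- exact: polytime_const.
- apply: polytime_addn; last exact/polytime_snd/polytime_id.
  exact: (polytime_comp (polytime_fst (polytime_id _)) pn).
Qed.

Lemma polytime_subn (G : encType) (m n : G -> nat) :
  polytime m -> polytime n -> polytime (fun x => m x - n x).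
Proof.
move=> pm pn; apply: (@eq_polytime _ _ (fun x => iter (n x) predn (m x))).
  by move=> x; rewrite iter_predn.
apply: (@polytime_iter _ _ _ _ (fun _ => predn) (fun=> 0)) => //.
- exact: poly_bounded_const.
- by move=> _ k; rewrite !esize_nat; lia.
- exact/polytime_predn/polytime_snd/polytime_id.
Qed.

Lemma polytime_leq (G : encType) (m n : G -> nat) :
  polytime m -> polytime n -> polytime (fun x => m x <= n x).
Proof.
move=> pm pn; apply: eq_polytime (polytime_if_truth (polytime_subn pm pn)
  (polytime_const _ false) (polytime_const _ true)) => x.
by rewrite /leq; case: (_ - _).
Qed.

Lemma polytime_eqn (G : encType) (m n : G -> nat) :
  polytime m -> polytime n -> polytime (fun x => m x == n x).
Proof.
move=> pm pn; apply: eq_polytime (polytime_andb (polytime_leq pm pn)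
  (polytime_leq pn pm)) => x; by rewrite eqn_leq.
Qed.

Lemma polytime_nth (G A : encType) (a : A) (l : G -> seq A) (n : G -> nat) :
  polytime l -> polytime n -> polytime (fun x => nth a (l x) (n x)).
Proof.
move=> pl pn.
apply: (@eq_polytime _ _ (fun x => head a (iter (n x) behead (l x)))) => [x|].
  have -> : iter (n x) behead (l x) = drop (n x) (l x).
    elim: (n x) => [|k IH]; first by rewrite drop0.
    by rewrite iterS IH -drop1 drop_drop add1n.
  by rewrite -nth0 nth_drop addn0.
apply: polytime_head.
apply: (@polytime_iter _ _ _ _ (fun _ => behead) (fun=> 0)) => //.
- exact: poly_bounded_const.
- by move=> _ [|c s] //=; rewrite esize_cons; lia.
- exact/polytime_behead/polytime_snd/polytime_id.
Qed.

(** * Bipartite matching by auction *)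

Section Auction.
Variables (V S : eqType) (adj : V -> S -> bool) (vs : seq V) (slots : seq S).

(* A log lists the bids made so far, latest first. The price of a slot is the
   number of bids on it, and its holder is its latest bidder. *)
Definition price (log : seq (V * S)) (j : S) : nat :=
  count (fun b => b.2 == j) log.

Definition bids_on (log : seq (V * S)) (j : S) : seq V :=
  [seq b.1 | b <- log & b.2 == j].

Definition holds (log : seq (V * S)) (v : V) (j : S) : bool :=
  ohead (bids_on log j) == Some v.

(** The price cap bounds the number of bids. It leaves [(size slots).+1] levels for [size slots]
    slots, so some level is attained by none; this is what refutes Hall's condition when a vote is
    stopped by the cap. *)
Definition may_bid (log : seq (V * S)) (b : V * S) : bool :=
  [&& adj b.1 b.2, ~~ has (fun j => holds log b.1 j) slots,
      price log b.2 <= size slots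
    & all (fun j => adj b.1 j ==> (price log b.2 <= price log j)) slots].

Definition bid (log : seq (V * S)) (b : V * S) : seq (V * S) :=
  if may_bid log b then b :: log else log.

(* Every effective bid raises a price, and no price exceeds [(size slots).+1];
   hence some round is idle, and so are all later ones. *)
Definition rounds : nat := ((size slots).+1 * size slots).+1.

Definition auction : seq (V * S) :=
  foldl bid [::]
    [seq b | _ <- iota 0 rounds, b <- [seq (v, j) | v <- vs, j <- slots]].

Definition matchable : bool :=
  all (fun v => has (fun j => holds auction v j) slots) vs.

Hypothesis uniq_slots : uniq slots.

(** The third clause is approximate complementary slackness: no admissible slot is cheaper than the
    held one by more than 1. *)
Definition valid_log (log : seq (V * S)) : Prop :=
  [/\ forall b, b \in log -> b.1 \in vs /\ b.2 \in slots,
      forall j, price log j <= (size slots).+1,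
      forall v j, holds log v j -> adj v j /\
        forall k, k \in slots -> adj v k -> price log j <= (price log k).+1
    & forall v j k, holds log v j -> holds log v k -> j = k].

Lemma holds_mem log v j : holds log v j -> (v, j) \in log.
Proof.
rewrite /holds /bids_on => /eqP h.
have: v \in [seq b.1 | b <- log & b.2 == j].
  by case: (map _ _) h => //= u s [->]; rewrite mem_head.
by case/mapP=> -[u k]; rewrite mem_filter /= => /andP[/eqP -> +] -> .
Qed.

Lemma holds_bid log v j u k :
  holds ((v, j) :: log) u k = if j == k then v == u else holds log u k.
Proof. by rewrite /holds /bids_on /=; case: ifP. Qed.

Lemma price_holder log j : 0 < price log j -> exists v, holds log v j.
Proof.
rewrite /price -size_filter /holds /bids_on.
by case: (filter _ _) => //= b s _; exists b.1.
Qed.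

(** A bid goes to a cheapest admissible slot and raises it by one, which gives slackness for the
    bidder; for other holders it survives because their price is unchanged and no price falls. The
    bidder held nothing before, so nobody holds two slots. *)
Lemma valid_bid log b : b.1 \in vs -> b.2 \in slots ->
  valid_log log -> valid_log (bid log b).
Proof.
case: b => v j /= vV jS [log_mem log_price log_adj log_inj].
rewrite /bid; case: ifP => //= /and4P[/= adj_vj free_v le_j /allP min_j].
have vfree k : ~~ holds log v k.
  apply/negP => h; case/negP: free_v; apply/hasP; exists k => //.
  by have [] := log_mem _ (holds_mem h).
split.
- by move=> b; rewrite inE => /predU1P[->|/log_mem].
- move=> k; rewrite /price /=; case: eqP => [<-|_]; last exact: log_price.
  by rewrite ltnS.
- move=> u k; rewrite holds_bid; case: eqP => [<- /eqP <-|jk hk].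
    split=> // i iS adj_vi; rewrite /price /= eqxx add1n ltnS.
    have /implyP/(_ adj_vi) := min_j _ iS.
    by move/leq_trans; apply; apply: leq_addl.
  have [adj_uk h] := log_adj _ _ hk; split=> // i iS adj_ui.
  rewrite /price /= (introF eqP jk) add0n.
  by apply: leq_trans (h _ iS adj_ui) _; rewrite ltnS leq_addl.
- move=> u k i; rewrite !holds_bid.
  case: (eqVneq j k) => [<-|_]; case: (eqVneq j i) => [<-|_] //.
  + by move/eqP<-; rewrite (negbTE (vfree _)).
  + by move=> + /eqP vu; rewrite -vu (negbTE (vfree _)).
  + exact: log_inj.
Qed.

Lemma valid_foldl log s :
  (forall b, b \in s -> b.1 \in vs /\ b.2 \in slots) ->
  valid_log log -> valid_log (foldl bid log s).
Proof.
elim: s log => //= b s IH log sP vlog; apply: IH.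
  by move=> c cs; apply: sP; rewrite inE cs orbT.
by have [] := sP b (mem_head _ _); move=> *; apply: valid_bid.
Qed.

Lemma size_bid log b : size log <= size (bid log b).
Proof. by rewrite /bid; case: ifP => //=. Qed.

Lemma size_foldl_bid log s : size log <= size (foldl bid log s).
Proof.
elim: s log => //= b s IH log; exact: leq_trans (size_bid log b) (IH _).
Qed.

(** The log never shrinks, so a pass that leaves its length unchanged has rejected every bid, each
    judged against [log] itself. *)
Lemma foldl_bid_stuck log s : size (foldl bid log s) <= size log ->
  forall b, b \in s -> ~~ may_bid log b.
Proof.
elim: s log => //= b s IH log le_s c.
have stuck : ~~ may_bid log b.
  apply: contraL le_s; rewrite -ltnNge => h.
  by apply: leq_trans (size_foldl_bid _ _); rewrite /bid h /=.
rewrite inE => /predU1P[->//|]; apply: IH.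
by move: le_s; rewrite /bid (negbTE stuck).
Qed.

(** Every bid is counted in the price of exactly one slot, so the length of the log is the sum of
    the prices. *)
Lemma size_valid log : valid_log log ->
  size log <= (size slots).+1 * size slots.
Proof.
case=> log_mem log_price _ _.
have -> : size log = \sum_(j <- slots) price log j.
  elim: log log_mem {log_price} => [|b log IH] log_mem /=.
    by rewrite big1.
  rewrite (IH (fun c h => log_mem c (mem_behead (s := b :: log) h))).
  rewrite /price /= big_split /= -(add1n (\sum_(_ <- _) _)); congr (_ + _).
  have [_ bS] := log_mem b (mem_head _ _).
  by rewrite (bigD1_seq _ bS uniq_slots) /= eqxx big1 // => j /negbTE; rewrite eq_sym => ->.
move: (size slots).+1 log_price => L log_price.
elim: slots => [|j s IH]; first by rewrite big_nil.
by rewrite big_cons /= mulnS leq_add.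
Qed.

Lemma auction_valid : valid_log auction.
Proof.
apply: valid_foldl => [b /allpairsPdep[i [c [_ /allpairsP[[v j] /= [vV jS ->]] ->]]]|].
  by [].
by split.
Qed.

Lemma auction_stuck b : b.1 \in vs -> b.2 \in slots -> ~~ may_bid auction b.
Proof.
case: b => v j /= vV jS.
set s := [seq (v, j) | v <- vs, j <- slots].
have vj_s : (v, j) \in s by apply/allpairsP; exists (v, j).
(* The auction repeats the same pass over all pairs. *)
have auctionE n : foldl bid [::] [seq b | _ <- iota 0 n, b <- s] =
    iter n (fun log => foldl bid log s) [::].
  elim: n => // n IH; rewrite iterS -IH -addn1 iotaD map_cat flatten_cat foldl_cat.
  by rewrite /= cats0 map_id.
have prefix_valid n : valid_log (foldl bid [::] [seq b | _ <- iota 0 n, b <- s]).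
  apply: valid_foldl => [b /allpairsPdep[i [c [_ /allpairsP[[u k] /= [? ? ->]] ->]]]|].
    by [].
  by split.
pose run n := iter n (fun log => foldl bid log s) [::].
rewrite /auction -/s auctionE -/(run _).
have run_stuck n : size (run n.+1) <= size (run n) -> run n.+1 = run n.
  rewrite {1 3}/run !iterS -/(run n); elim: (s) (run n) => //= c t IH log h.
  have : ~~ may_bid log c.
    by apply: (foldl_bid_stuck (s := c :: t) h); rewrite mem_head.
  by move=> nb; move: h; rewrite /bid (negbTE nb) => /IH.
(* As long as no pass is idle, each adds a bid; after an idle pass the log is constant. *)
have grow n : n <= size (run n) \/ run n.+1 = run n.
  elim: n => [|n [IH|IH]]; [by left| |].
    have [lt|/run_stuck h] := ltnP (size (run n)) (size (run n.+1)).
      by left; apply: leq_trans lt.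
    by right; rewrite {1}/run iterS -/(run n.+1) h.
  by right; rewrite {1}/run iterS -/(run n.+1) IH.
have [] := grow rounds.
  have := size_valid (prefix_valid rounds); rewrite auctionE -/(run _) /rounds.
  by move=> le1 le2; have := leq_trans le2 le1; rewrite ltnn.
move=> h; apply: (foldl_bid_stuck (s := s)) vj_s.
by rewrite -[foldl _ _ _]/(run rounds.+1) h.
Qed.

(* There are more prices below [(size slots).+1] than slots, so one of them is
   attained by no slot. *)
Lemma auction_gap v : v \in vs -> ~~ has (holds auction v) slots ->
  exists l,
    (forall j, j \in slots -> adj v j -> l < price auction j) /\
    (forall u j k, holds auction u j -> l < price auction j ->
       k \in slots -> adj u k -> l < price auction k).
Proof.
have [log_mem log_price log_adj log_inj] := auction_valid.
move=> vV v_free.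
have [l lt_l gap] : exists2 l, l < (size slots).+1 &
    l \notin map (price auction) slots.
  have /allPn[l] : ~~ all (mem (map (price auction) slots))
      (iota 0 (size slots).+1).
    apply/negP => /allP sub.
    have := uniq_leq_size (iota_uniq _ _) sub.
    by rewrite size_iota size_map ltnn.
  by rewrite mem_iota add0n; exists l.
exists l; split=> [j jS adj_vj|u j k hj lt_j kS adj_uk].
  suff: size slots < price auction j by apply: leq_trans.
  have ex_n : exists n, has (fun j => adj v j && (price auction j == n)) slots.
    by exists (price auction j); apply/hasP; exists j; rewrite ?adj_vj /=.
  case: (ex_minnP ex_n) => n /hasP[k kS /andP[adj_vk /eqP nE]] min_n.
  have min_k i : i \in slots -> adj v i -> price auction k <= price auction i.
    by move=> iS adj_vi; rewrite nE min_n //; apply/hasP; exists i; rewrite ?adj_vi /=.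
  (* The vote is free and [k] is a cheapest admissible slot, so only the price cap can prevent the
     bid. *)
  have := @auction_stuck (v, k) vV kS; rewrite /may_bid /= adj_vk v_free /=.
  rewrite negb_and -ltnNge => /orP[/leq_trans->//|]; first exact: min_k.
  by case/allPn=> i iS; rewrite negb_imply => /andP[adj_vi]; rewrite min_k.
(* By slackness the price of [k] is at least [l], and it is not [l] since no slot attains that
   level. *)
have [_ /(_ k kS adj_uk) le_j] := log_adj _ _ hj.
have : l != price auction k by apply: contraNneq gap => ->; apply: map_f.
by rewrite ltn_neqAle => -> /=; rewrite -ltnS; apply: leq_trans le_j.
Qed.

(** If a vote stays free, the slots above the gap are held by distinct votes, all different from it.
    These holders and the free vote admit only slots above the gap, so an injective assignment would
    have to place one vote too many there. *)
Lemma matchableP (j0 : S) :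
  reflect (exists f : V -> S,
      {in vs, forall v, f v \in slots /\ adj v (f v)} /\ {in vs &, injective f})
    matchable.
Proof.
have [log_mem log_price log_adj log_inj] := auction_valid.
apply: (iffP allP) => [all_held|[f [f_adj f_inj]] v vV].
  exists (fun v => nth j0 slots (find (holds auction v) slots)).
  split=> [v /all_held h|u v /all_held hu /all_held hv].
    have := nth_find j0 h => /log_adj[adj_v _]; split=> //.
    by rewrite mem_nth -?has_find.
  move=> e; have := nth_find j0 hu; have := nth_find j0 hv; rewrite -e.
  by rewrite /holds => /eqP -> /eqP[].
apply/negPn/negP => v_free; have [l [adj_v adj_u]] := auction_gap vV v_free.
pose high := [seq j <- slots | l < price auction j].
pose holder j := head v (bids_on auction j).
have holderP j : j \in high -> holds auction (holder j) j.
  rewrite mem_filter => /andP[lt_j _].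
  have [u] := price_holder (leq_ltn_trans (leq0n l) lt_j).
  by rewrite /holds /holder; case: (bids_on _ _).
pose us := v :: map holder high.
have us_vs : {subset us <= vs}.
  move=> u; rewrite inE => /predU1P[->//|/mapP[j /holderP/holds_mem hj ->]].
  by have [] := log_mem _ hj.
have uniq_us : uniq us.
  rewrite /= map_inj_in_uniq ?filter_uniq // ?andbT.
    apply/mapP => -[j j_high vE]; case/negP: v_free; apply/hasP; exists j.
      by move: j_high; rewrite mem_filter => /andP[].
    by rewrite vE holderP.
  move=> j k /holderP hj /holderP hk jk; apply: log_inj hj _.
  by rewrite jk.
have : size (map f us) <= size high.
  apply: uniq_leq_size.
    by rewrite map_inj_in_uniq // => u w /us_vs uV /us_vs wV; apply: f_inj.
  move=> _ /mapP[u u_us ->]; have [fS adj_uf] := f_adj _ (us_vs _ u_us).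
  rewrite mem_filter fS andbT.
  move: u_us adj_uf fS; rewrite inE => /predU1P[-> | /mapP[j j_high ->]] adj_uf fS.
    exact: adj_v.
  apply: adj_u (holderP _ j_high) _ fS adj_uf.
  by move: j_high; rewrite mem_filter => /andP[].
by rewrite !size_map /= size_map ltnn.
Qed.

End Auction.

(** * Extensions of partial orders and the runoff *)

(** A profile may contain equal votes, so votes are counted through their positions. *)
Lemma count_card_ord (T : Type) (x0 : T) (p : pred T) (s : seq T) n :
  size s = n -> count p s = #|[set i : 'I_n | p (nth x0 s i)]|.
Proof.
move=> <-; rewrite -sum1_count (big_nth x0) big_mkord sum1dep_card.
by rewrite cardsE.
Qed.

Lemma set_between (T : finType) (A B : {set T}) k :
  A \subset B -> #|A| <= k <= #|B| ->
  exists2 X : {set T}, (A \subset X) && (X \subset B) & #|X| = k.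
Proof.
move=> AB /andP[]; elim: k => [|k IH] Ak kB.
  by exists A; rewrite ?subxx //; apply/eqP; rewrite -leqn0.
move: Ak; rewrite leq_eqVlt => /predU1P[<-|]; first by exists A; rewrite ?subxx.
rewrite ltnS => /IH /(_ (ltnW kB)) [X /andP[AX XB] Xk].
have /properP[_ [x xB xX]] : X \proper B by rewrite properEcard XB Xk.
exists (x |: X); last by rewrite cardsU1 xX Xk.
by rewrite subUset sub1set xB XB (subset_trans AX) ?subsetUr.
Qed.

Lemma card_disjointU (T : finType) (A B : {set T}) :
  (forall x, x \in A -> x \notin B) -> #|A| + #|B| = #|A :|: B|.
Proof.
move=> AB; rewrite -cardsUI; have -> : A :&: B = set0; last by rewrite cards0 addn0.
by apply/setP => x; rewrite !inE; apply/negP => /andP[/AB/negP].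
Qed.

Lemma card_bounded_slots (T : finType) (A : {set T}) (g : T -> nat) k :
  {in A &, injective g} -> (forall i, i \in A -> g i < k) -> #|A| <= k.
Proof.
move=> g_inj g_lt; rewrite cardE -(size_map g) -(size_iota 0 k).
apply: uniq_leq_size.
  rewrite map_inj_in_uniq ?enum_uniq // => i j.
  by rewrite !mem_enum; apply: g_inj.
by move=> _ /mapP[i + ->]; rewrite mem_enum mem_iota => /g_lt.
Qed.

(** * Linear extensions of a single vote *)

Section Orders.
Variable C : finType.
Implicit Types (O V : relation C) (a b d e x y : C).

Definition undominated O a : bool := [forall b, ((b, a) \in O) ==> (b == a)].

Definition ranks_first V a : bool := [forall b, (a, b) \in V].

Lemma undominatedP O a :
  reflect (forall b, (b, a) \in O -> b = a) (undominated O a).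
Proof.
apply: (iffP forallP) => h b; first by move=> ba; apply/eqP; apply: implyP (h b) ba.
by apply/implyP => /h ->.
Qed.

(** Only the pairs forced by transitivity are added; a cycle through them would already put [(y, x)]
    in [O]. *)
Lemma add_pair O x y : is_partial_order O -> (y, x) \notin O ->
  exists O', [/\ is_partial_order O', O \subset O' & (x, y) \in O'].
Proof.
case=> refl anti trans nyx.
pose O' : relation C := O :|: [set p | ((p.1, x) \in O) && ((y, p.2) \in O)].
exists O'; split; last by rewrite !inE /= !refl orbT.
  split=> [a|a b|a b c]; rewrite !inE /= ?refl //.
    case/orP=> [ab|/andP[ax yb]]; case/orP => [ba|/andP[bx ya]].
    - exact: anti.
    - by case/negP: nyx; apply: trans ya (trans _ _ _ ab bx).
    - by case/negP: nyx; apply: trans yb (trans _ _ _ ba ax).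
    - by case/negP: nyx; apply: trans yb bx.
  case/orP=> [ab|/andP[ax yb]]; case/orP => [bc|/andP[bx yc]].
  - by rewrite (trans _ _ _ ab bc).
  - by rewrite (trans _ _ _ ab bx) yc orbT.
  - by rewrite ax (trans _ _ _ yb bc) orbT.
  - by case/negP: nyx; apply: trans yb bx.
exact: subsetUl.
Qed.

(** Szpilrajn's theorem for finite orders: incomparable pairs are ordered one at a time, by
    induction on the number of pairs outside the relation. *)
Lemma linear_extension O : is_partial_order O ->
  exists2 V, is_linear_order V & O \subset V.
Proof.
move En : #|~: O| => n; elim/ltn_ind: n O En => n IH O En po.
have [/forallP tot|/forallPn[x /forallPn[y]]] :=
    boolP [forall x, [forall y, ((x, y) \in O) || ((y, x) \in O)]].
  exists O => //; split=> // a b; apply/orP.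
  by move: (tot a) => /forallP.
rewrite negb_or => /andP[nxy nyx].
have [O' [po' OO' xy]] := add_pair po nyx.
have lt : #|~: O'| < n.
  rewrite -En; apply: proper_card; rewrite properE setCS OO' /=.
  by apply/subsetPn; exists (x, y); rewrite !inE ?xy.
have [V linV O'V] := IH _ lt O' erefl po'.
by exists V => //; apply: subset_trans O'V.
Qed.

Definition raise V a : relation C :=
  [set p | (p.1 == a) || (p.2 != a) && (p \in V)].

Lemma raise_linear V a : is_linear_order V -> is_linear_order (raise V a).
Proof.
case=> -[refl anti trans] tot; split; first split.
- by move=> x; rewrite inE /= refl andbT orbN.
- move=> x y; rewrite !inE /=.
  have [->|xa] := eqVneq x a; have [->|ya] := eqVneq y a => //=.
  exact: anti.
- move=> x y z; rewrite !inE /=.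
  have [->|xa] //= := eqVneq x a; have [->|ya] //= := eqVneq y a.
  move=> xy /andP[-> yz]; exact: trans xy yz.
- move=> x y; rewrite !inE /=.
  by have [->|xa] := eqVneq x a; have [->|ya] := eqVneq y a => /=; auto.
Qed.

Lemma raise_first V a : ranks_first (raise V a) a.
Proof. by apply/forallP => b; rewrite inE eqxx. Qed.

Lemma raise_extends O V a :
  O \subset V -> undominated O a -> O \subset raise V a.
Proof.
move=> /subsetP OV /undominatedP top_a; apply/subsetP => -[x y] xyO.
rewrite inE /= (OV _ xyO) andbT; have [ya|_] := eqVneq y a; last by rewrite orbT.
by rewrite (top_a x) ?eqxx // -ya.
Qed.

(** First [d] is put above [e] if the vote allows it, then [a] is raised to the top. Raising an
    alternative other than [e] cannot bring [e] above [d]. *)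
Lemma realize_vote O a d e : is_partial_order O -> undominated O a ->
  exists V, [/\ is_linear_order V, O \subset V, ranks_first V a
    & e != a -> (e, d) \notin O -> (d, e) \in V].
Proof.
move=> po top_a.
have [V [linV OV de]] : exists V, [/\ is_linear_order V, O \subset V
    & (e, d) \notin O -> (d, e) \in V].
  have [ed|ned] := boolP ((e, d) \in O).
    by have [V linV OV] := linear_extension po; exists V.
  have [O' [po' OO' de]] := add_pair po ned.
  have [V linV O'V] := linear_extension po'.
  exists V; split=> // [|_]; first exact: subset_trans O'V.
  exact: (subsetP O'V).
exists (raise V a); split.
- exact: raise_linear.
- exact: raise_extends.
- exact: raise_first.
- by move=> ea /de deV; rewrite inE /= ea deV orbT.
Qed.

Lemma ranks_first_inj V a b :
  is_linear_order V -> ranks_first V a -> ranks_first V b -> a = b.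
Proof.
by move=> [[_ anti _] _] /forallP/(_ b) ab /forallP/(_ a); apply: anti.
Qed.

(** An alternative with the most alternatives below it is on top, since anything above it would have
    strictly more. *)
Lemma ranks_first_exists V (a0 : C) :
  is_linear_order V -> exists a, ranks_first V a.
Proof.
move=> [[refl anti trans] tot].
have [a _ max_a] := @arg_maxnP C a0 predT (fun a => #|[set b | (a, b) \in V]|) isT.
exists a; apply/forallP => b; apply/negPn/negP => nab.
have ba : (b, a) \in V by case: (tot a b) nab => // ->.
have := max_a b isT; apply/negP; rewrite -ltnNge; apply: proper_card.
rewrite properE; apply/andP; split.
  by apply/subsetP => x; rewrite !inE; apply: trans.
by apply/subsetPn; exists b; rewrite !inE ?refl.
Qed.

Lemma ranks_first_undominated O V a : is_linear_order V -> O \subset V ->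
  ranks_first V a -> undominated O a.
Proof.
move=> [[_ anti _] _] /subsetP OV /forallP top_a; apply/undominatedP => b ba.
exact: anti (OV _ ba) (top_a b).
Qed.

End Orders.

(** * Winners of the runoff *)

Section Runoff.
Variables (C : finType) (P : seq (relation C)).

(** A most frequent top alternative and a best one among the rest form an admissible pair of
    finalists; a lone alternative is its own runoff. Of at most two finalists, one does not lose to
    the other. *)
Lemma runoff_nonempty (c0 : C) : exists c, c \in plurality_runoff P.
Proof.
have [a _ max_a] := @arg_maxnP C c0 predT (top_count P) isT.
have [S aS finS] : exists2 S : {set C}, a \in S & finalists P S /\ #|S| <= 2.
  have [/existsP[b ba]|/existsPn all_a] := boolP [exists b, b != a].
    have [d /= da max_d] := @arg_maxnP C b [pred x | x != a] (top_count P) ba.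
    exists [set a; d]; first exact: set21.
    have card2 : #|[set a; d]| = 2 by rewrite cards2 eq_sym da.
    split; last by rewrite card2.
    apply/andP; split.
      by rewrite card2 eq_sym; apply/eqP/minn_idPl; rewrite -card2 max_card.
    apply/forall_inP => x; rewrite !inE => xS.
    apply/forall_inP => y; rewrite !inE negb_or => /andP[ya yd].
    by case/pred2P: xS => ->; [apply: max_a|apply: max_d].
  exists [set a]; first exact: set11.
  have fullE : [set a] = setT.
    by apply/setP => x; rewrite !inE; move: (all_a x); rewrite negbK.
  rewrite cards1; split=> //; apply/andP; split.
    by rewrite -cardsT -fullE cards1.
  apply/forall_inP => x _; apply/forall_inP => y; rewrite fullE.
  by rewrite !inE.
have [fS S2] := finS.
pose beats x := [forall y in S, (y != x) ==> (pref_count P y x <= pref_count P x y)].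
suff [x xS bx] : exists2 x, x \in S & beats x.
  exists x; rewrite inE; apply/existsP; exists S; rewrite fS /=.
  by apply/andP.
have [ba|/forallPn[b]] := boolP (beats a); first by exists a.
rewrite !negb_imply -ltnNge => /and3P[bS ba lt_ba].
exists b => //; apply/forall_inP => y yS; apply/implyP => yb.
have [->|ya] := eqVneq y a; first exact: ltnW.
(* A third finalist is impossible. *)
have : #|[set a; b; y]| <= #|S|.
  by apply: subset_leq_card; rewrite !subUset !sub1set aS bS.
move/leq_trans => /(_ _ S2); rewrite setUC cardsU1 cards2 !inE.
by rewrite (negbTE ya) (negbTE yb) eq_sym ba.
Qed.

(** Both kinds of tie-breaking are expressed by weak inequalities: two or more alternatives make the
    set of finalists a pair, and [e] is the other member. *)
Lemma runoff_winnerP d : #|C| > 1 ->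
  reflect (exists e, [/\ e != d,
      forall a, a != d -> a != e ->
        top_count P a <= top_count P d /\ top_count P a <= top_count P e
    & pref_count P e d <= pref_count P d e])
    (d \in plurality_runoff P).
Proof.
move=> C2; have min2 : minn 2 #|C| = 2 by apply/minn_idPl.
rewrite inE; apply: (iffP existsP) => [[S]|[e [ed tops pref]]].
  case/andP=> /andP[]; rewrite min2 => /cards2P[x [y [xy ->]]] /forall_inP tops.
  case/andP=> dS /forall_inP pref.
  wlog dx : x y xy tops dS pref / d = x.
    move=> wl; case/set2P: (dS) => dE; first exact: (wl x y).
    by apply: (wl y x); rewrite 1?eq_sym 1?setUC.
  subst x; exists y; rewrite eq_sym xy; split=> //.
    move=> a ad ay; have aS : a \in ~: [set d; y] by rewrite !inE negb_or ad.
    by split; [have /forall_inP := tops d (set21 _ _)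
              |have /forall_inP := tops y (set22 _ _)]; apply.
  by apply: (implyP (pref y (set22 _ _))); rewrite eq_sym.
exists [set d; e]; rewrite /finalists /runoff_winner min2 cards2 [d == e]eq_sym ed set21 /=.
apply/andP; split.
  apply/forall_inP => x xS; apply/forall_inP => a; rewrite !inE negb_or.
  by case/andP=> ad ae; have [h1 h2] := tops _ ad ae; case/set2P: xS => ->.
apply/forall_inP => x /set2P[|] ->; first by rewrite eqxx.
by apply/implyP.
Qed.

End Runoff.

(** * Spoiling extensions, matchings and counting *)

Section Core.
Variables (C : finType) (P : seq (relation C)) (d e : C).
Hypotheses (P_po : partial_profile P) (ed : e != d).
Let n := size P.

(* The votes whose placement is decided by the matching. *)
Definition flexible (O : relation C) : bool :=
  ~~ undominated O d && ~~ (undominated O e && ((e, d) \in O)).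

(* [T] is the number of first places that [d] and [e] must reach and the others
   may not exceed, and [K] bounds the number of votes that rank [e] first without
   being already committed to prefer [e] to [d]. *)
Definition assignable (T K : nat) : Prop :=
  exists f : nat -> C * nat,
    (forall i, i < n -> flexible (nth set0 P i) ->
       [/\ (f i).1 != d, undominated (nth set0 P i) (f i).1
         & (f i).2 < (if (f i).1 == e then K else T)]) /\
    (forall i j, i < n -> j < n -> flexible (nth set0 P i) ->
       flexible (nth set0 P j) -> f i = f j -> i = j).

(** The first three conditions are Hall's condition for giving [d] and [e] disjoint sets of [T]
    first places. The fourth keeps the votes that may end up preferring [e] to [d] within one half,
    and the last lets [e] reach [T] with at most [K] votes beyond the committed ones. *)
Definition enough_tops (T K : nat) : bool :=
  [&& T <= count (fun O : relation C => undominated O d) P,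
      T <= count (fun O : relation C => undominated O e) P,
      T.*2 <= count (fun O : relation C => undominated O d || undominated O e) P,
      (K + count (fun O : relation C => (e, d) \in O) P).*2 <= n
    & T <= count (fun O : relation C => undominated O e && ((e, d) \in O)) P + K].

Definition spoiled : Prop :=
  exists Q, [/\ complete_profile Q, extends Q P,
    forall a, a != d -> a != e ->
      top_count Q a <= top_count Q d /\ top_count Q a <= top_count Q e
    & pref_count Q e d <= pref_count Q d e].

(** The parameters and the matching are read off the spoiling extension, each flexible vote going to
    the alternative it ranks first there. *)
Lemma spoiled_assignable : spoiled ->
  exists T K, [/\ T <= n, K <= n, enough_tops T K & assignable T K].
Proof.
case=> Q [Q_lin]; rewrite /extends all2E => /andP[/eqP sizeQ /allP extQ] tops pref.
have sQ : size Q = n by [].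
pose O (i : nat) := nth set0 P i; pose V (i : nat) := nth set0 Q i.
have linV i : i < n -> is_linear_order (V i).
  by move=> lt_i; apply: Q_lin; apply: mem_nth; rewrite sQ.
have OV i : i < n -> O i \subset V i.
  move=> lt_i; apply: (extQ (O i, V i)); rewrite -nth_zip //.
  by apply: mem_nth; rewrite size_zip sQ minnn.
have [t topt] : exists t : nat -> C, forall i, i < n -> ranks_first (V i) (t i).
  have [t topt] : exists t : 'I_n -> C, forall i : 'I_n, ranks_first (V i) (t i).
    apply: (@fin_all_exists 'I_n (fun=> C) (fun i a => ranks_first (V i) a)).
    by move=> i; apply: ranks_first_exists d (linV i _).
  exists (fun i : nat => if (insub i : option 'I_n) is Some j then t j else d) => i lt_i.
  by rewrite insubT; exact: (topt (Ordinal lt_i)).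
have topE a i : i < n -> ranks_first (V i) a = (t i == a).
  move=> lt_i; apply/idP/eqP => [|<-]; last exact: topt.
  by move=> Va; apply: ranks_first_inj (linV i lt_i) (topt i lt_i) Va.
have und i : i < n -> undominated (O i) (t i).
  by move=> lt_i; apply: ranks_first_undominated (linV i lt_i) (OV i lt_i) (topt i lt_i).
have topcount a : top_count Q a = #|[set i : 'I_n | t i == a]|.
  rewrite /top_count (count_card_ord set0 _ sQ); apply: eq_card => i.
  by rewrite !inE -topE.
(* [T] is the largest number of first places that both finalists reach; [KS] collects those of [e]
   in votes not committed to it, and its size serves as [K]. *)
pose T := minn (top_count Q d) (top_count Q e).
pose KS := [set i : 'I_n | (t i == e) && ~~ (undominated (O i) e && ((e, d) \in O i))].
have cardP p : count p P = #|[set i : 'I_n | p (O i)]|.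
  exact: count_card_ord.
have pref_de : pref_count Q e d + pref_count Q d e <= n.
  rewrite /pref_count -[leqRHS]sQ -count_predUI.
  have -> : count (predI (fun V : relation C => (e, d) \in V)
      (fun V : relation C => (d, e) \in V)) Q = 0.
    apply/eqP; rewrite -leqn0 leqNgt -has_count; apply/hasPn => W /Q_lin[[_ anti _] _].
    by apply/negP => /andP[/= h1 h2]; move: ed; rewrite (anti _ _ h1 h2) eqxx.
  by rewrite addn0 count_size.
exists T, #|KS|; split.
- apply: leq_trans (geq_minl _ _) _; rewrite -sQ; exact: count_size.
- by rewrite -[leqRHS]card_ord max_card.
- apply/and5P; split.
  + apply: leq_trans (geq_minl _ _) _; rewrite topcount cardP.
    by apply/subset_leq_card/subsetP => i; rewrite !inE => /eqP <-; apply: und.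
  + apply: leq_trans (geq_minr _ _) _; rewrite topcount cardP.
    by apply/subset_leq_card/subsetP => i; rewrite !inE => /eqP <-; apply: und.
  + rewrite -addnn; apply: leq_trans (leq_add (geq_minl _ _) (geq_minr _ _)) _.
    rewrite !topcount cardP card_disjointU; last first.
      by move=> i; rewrite !inE => /eqP ->; rewrite eq_sym.
    apply/subset_leq_card/subsetP => i; rewrite !inE.
    by case/orP => /eqP <-; rewrite und ?orbT.
  (* The two kinds of votes are disjoint and all prefer [e] to [d] in [Q], where at most half of the
     votes do so. *)
  + suff : #|KS| + count (fun O : relation C => (e, d) \in O) P <= pref_count Q e d by lia.
    rewrite cardP card_disjointU; last first.
      move=> i; rewrite !inE => /andP[/eqP ti]; apply: contra => ->.
      by rewrite andbT -ti und.
    rewrite /pref_count (count_card_ord set0 _ sQ).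
    apply/subset_leq_card/subsetP => i; rewrite !inE => /orP[/andP[/eqP ti _]|].
      by have /forallP := topt i (ltn_ord i); rewrite ti; apply.
    exact: (subsetP (OV i _)).
  + apply: leq_trans (geq_minr _ _) _; rewrite topcount cardP.
    apply: leq_trans (leq_card_setU _ _); apply/subset_leq_card/subsetP => i.
    by rewrite !inE => ->; case: (_ && _).
(* Flexible votes with the same first alternative are numbered in order, so distinct votes get
   distinct slots. *)
pose rank i := #|[set j : 'I_n | [&& j < i, flexible (O j) & t j == t i]]|.
exists (fun i => (t i, rank i)); split=> [i lt_i flex_i|i j lt_i lt_j flex_i flex_j] /=.
  have td : t i != d.
    by apply: contraTneq flex_i => ti; rewrite negb_and -{1}ti und.
  split=> //; first exact: und.
  (* Vote [i] lies in [A] but is not counted by its own rank, which makes the bound strict. *)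
  have rank_lt (A : {set 'I_n}) :
      (forall j : 'I_n, flexible (O j) -> t j = t i -> j \in A) -> rank i < #|A|.
    move=> subA; apply: proper_card; apply/properP; split.
      apply/subsetP => j; rewrite inE => /and3P[_ fj /eqP tj]; exact: subA.
    by exists (Ordinal lt_i); rewrite ?subA // inE ltnn.
  case: eqP => te.
    by apply: rank_lt => j /andP[_ ne] tj; rewrite inE tj te eqxx ne.
  have [le1 le2] := tops (t i) td (introN eqP te).
  apply: (@leq_trans (top_count Q (t i))); last by rewrite leq_min le1.
  by rewrite topcount; apply: rank_lt => j _ tj; rewrite inE tj.
case=> tij rij.
wlog lt_ij : i j lt_i lt_j flex_i flex_j tij rij / i < j.
  move=> wl; case: (ltngtP i j) => // lt; first exact: wl.
  by apply/esym; apply: wl.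
suff : rank i < rank j by rewrite rij ltnn.
apply: proper_card; apply/properP; split.
  apply/subsetP => k; rewrite !inE => /and3P[lt_k -> /eqP ->].
  by rewrite tij eqxx (ltn_trans lt_k).
by exists (Ordinal lt_i); rewrite !inE /= ?ltnn ?lt_ij ?flex_i ?tij ?eqxx.
Qed.

(** First places go to [e] on a set [X], to [d] on the remaining votes where [d] is undominated, and
    by the matching elsewhere; the slots then keep every other alternative within [T]. *)
Lemma assignable_spoiled T K : enough_tops T K -> assignable T K -> spoiled.
Proof.
case/and5P => Td Te Tde Kn TK [f [f_ok f_inj]].
pose O (i : nat) := nth set0 P i.
have poO i : i < n -> is_partial_order (O i).
  by move=> lt_i; apply: P_po; apply: mem_nth.
have cardP p : count p P = #|[set i : 'I_n | p (O i)]|.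
  exact: count_card_ord.
pose PD := [set i : 'I_n | undominated (O i) d].
pose PE := [set i : 'I_n | undominated (O i) e].
pose FE := [set i : 'I_n | (e, d) \in O i].
pose Z := [set i : 'I_n | undominated (O i) e && ((e, d) \in O i)].
pose Y := [set i : 'I_n | flexible (O i) && ((f i).1 == e)].
rewrite !cardP -/PD -/PE -/FE -/Z in Td Te Tde Kn TK.
have YK : #|Y| <= K.
  apply: (@card_bounded_slots _ _ (fun i : 'I_n => (f i).2)).
    move=> i j; rewrite !inE => /andP[fi /eqP ei] /andP[fj /eqP ej] ij.
    apply: val_inj; apply: f_inj (ltn_ord i) (ltn_ord j) fi fj _.
    by rewrite [f i]surjective_pairing [f j]surjective_pairing ei ej ij.
  by move=> i; rewrite inE => /andP[fi ei]; have [_ _] := f_ok i (ltn_ord i) fi; rewrite ei.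
have YPE : Y \subset PE.
  apply/subsetP => i; rewrite !inE => /andP[fi /eqP <-].
  by have [] := f_ok i (ltn_ord i) fi.
have ZPE : Z \subset PE by apply/subsetP => i; rewrite !inE => /andP[].
have YZD : [disjoint Y :|: Z & PD].
  rewrite -setI_eq0; apply/eqP/setP => i; rewrite !inE; apply/negP.
  case/andP=> /orP[/andP[/andP[nd _] _]|/andP[_ fe]] di; first by case/negP: nd.
  by have := undominatedP _ _ di _ fe; apply/eqP.
(* [X] will be the set of votes that rank [e] first: the matching and the
   committed votes prescribe [Y :|: Z], then votes that cannot go to [d] are
   added before those that can. *)
have [X [YZX XPE TX TXD XK]] : exists X : {set 'I_n},
    [/\ Y :|: Z \subset X, X \subset PE, T <= #|X|, T <= #|PD :\: X|
      & #|X :\: Z| <= K].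
  have subYZ : Y :|: Z \subset PE by rewrite subUset YPE.
  (* For a set of exactly [T] votes containing [Z], the last condition of [enough_tops] leaves at
     most [K] votes outside [Z]. *)
  have cardXZ (X : {set 'I_n}) : Z \subset X -> #|X| = T -> #|X :\: Z| <= K.
    by move=> ZX XT; rewrite cardsD (setIidPr ZX) XT leq_subLR.
  have [le_T|lt_T] := leqP T #|Y :|: Z|.
    exists (Y :|: Z); split=> //.
      rewrite (_ : PD :\: _ = PD) //; apply/setDidPl.
      by rewrite disjoint_sym.
    apply: leq_trans YK; apply: subset_leq_card.
    by rewrite setDUl setDv setU0 subsetDl.
  have ZYZ : Z \subset Y :|: Z by apply: subsetUr.
  have YZCC : Y :|: Z \subset PE :\: PD by rewrite subsetD subYZ.
  have [le_T|gt_T] := leqP T #|PE :\: PD|.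
    have [||X /andP[YZX XCC] XT] := @set_between _ (Y :|: Z) (PE :\: PD) T => //.
      by rewrite le_T ltnW.
    have [XPE XD] : X \subset PE /\ [disjoint X & PD].
      by apply/andP; rewrite -subsetD.
    exists X; split; rewrite ?XT //.
      rewrite (_ : PD :\: _ = PD) //; apply/setDidPl.
      by rewrite disjoint_sym.
    by apply: cardXZ => //; apply: subset_trans YZX.
  (* Now [e] takes all its votes out of reach of [d] and some others, [T] in all. The votes that [d]
     or [e] can head number at least twice [T] and are covered by [X] and [PD :\: X], which leaves
     [T] for [d]. *)
  have [||X /andP[CCX XPE] XT] := @set_between _ (PE :\: PD) PE T.
  - exact: subsetDl.
  - by rewrite Te ltnW.
  exists X; split; rewrite ?XT //.
  - exact: subset_trans CCX.
  - have : T.*2 <= #|(PD :\: X) :|: X|.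
      apply: leq_trans Tde _; apply/subset_leq_card/subsetP => i.
      rewrite inE => h; rewrite inE inE; case: (boolP (i \in X)) => //= niX.
      have := contra (subsetP CCX i) niX; rewrite !inE in h *.
      by case: (undominated (O i) d) h => //= ->.
    by have [+ _] := leq_card_setU (PD :\: X) X; rewrite XT; lia.
  - by apply: cardXZ => //; apply: subset_trans (subset_trans YZCC CCX).
pose t (i : 'I_n) := if i \in X then e else if i \in PD then d else (f i).1.
have flex i : i \notin X -> i \notin PD -> flexible (O i).
  move=> niX niPD; rewrite /flexible; rewrite inE in niPD; rewrite niPD /=.
  apply/negP => h; case/negP: niX; apply: (subsetP YZX).
  by rewrite !inE h orbT.
have und (i : 'I_n) : undominated (O i) (t i).
  rewrite /t; case: ifPn => [/(subsetP XPE)|niX]; first by rewrite inE.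
  case: ifPn => [|niPD]; first by rewrite inE.
  by have [] := f_ok i (ltn_ord i) (flex i niX niPD).
(* The matching gives [e] only votes of [Y], which lie in [X]. *)
have te i : t i = e -> i \in X.
  rewrite /t; case: ifPn => // niX; case: ifPn => [_ /esym/eqP|niPD fi].
    by rewrite (negbTE ed).
  have flex_i := flex i niX niPD; case/negP: niX; apply: (subsetP YZX).
  by rewrite !inE flex_i fi eqxx.
have [V VP] : exists V : 'I_n -> relation C, forall i,
    [/\ is_linear_order (V i), O i \subset V i, ranks_first (V i) (t i)
      & e != t i -> (e, d) \notin O i -> (d, e) \in V i].
  apply: (@fin_all_exists 'I_n (fun=> relation C) (fun i V =>
    [/\ is_linear_order V, O i \subset V, ranks_first V (t i)
      & e != t i -> (e, d) \notin O i -> (d, e) \in V])).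
  by move=> i; apply: realize_vote (und i); apply: poO.
pose Q := [seq V i | i <- enum 'I_n].
have sQ : size Q = n by rewrite size_map size_enum_ord.
have nthQ (i : 'I_n) : nth set0 Q i = V i.
  by rewrite (nth_map i) ?size_enum_ord // nth_ord_enum.
have topE a : top_count Q a = #|[set i : 'I_n | t i == a]|.
  rewrite /top_count (count_card_ord set0 _ sQ); apply: eq_card => i.
  rewrite !inE nthQ; have [linV _ Vt _] := VP i.
  apply/idP/eqP => [Va|<-]; last exact: Vt.
  exact: ranks_first_inj linV Vt Va.
have le_te : T <= top_count Q e.
  rewrite topE; apply: leq_trans TX _; apply/subset_leq_card/subsetP => i iX.
  by rewrite inE /t iX.
have le_td : T <= top_count Q d.
  rewrite topE; apply: leq_trans TXD _; apply/subset_leq_card/subsetP => i.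
  by rewrite in_setD inE /t => /andP[/negbTE -> ->].
exists Q; split.
- by move=> _ /mapP[i _ ->]; have [] := VP i.
- rewrite /extends all2E sQ eqxx /=; apply/(all_nthP (set0, set0)) => i.
  rewrite size_zip sQ minnn => lt_i; rewrite nth_zip //=.
  by rewrite (nthQ (Ordinal lt_i)); have [] := VP (Ordinal lt_i).
- move=> a ad ae; suff le_a : top_count Q a <= T.
    by split; apply: leq_trans le_a _.
  have aP i : t i = a -> flexible (O i) /\ (f i).1 = a.
    rewrite /t; case: ifPn => [_ /esym/eqP|niX]; first by rewrite (negbTE ae).
    case: ifPn => [_ /esym/eqP|niPD fi]; first by rewrite (negbTE ad).
    by split=> //; apply: flex.
  rewrite topE; apply: (@card_bounded_slots _ _ (fun i : 'I_n => (f i).2)).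
    move=> i j; rewrite !inE => /eqP/aP[fi ei] /eqP/aP[fj ej] ij.
    apply: val_inj; apply: f_inj (ltn_ord i) (ltn_ord j) fi fj _.
    by rewrite [f i]surjective_pairing [f j]surjective_pairing ei ej ij.
  move=> i; rewrite inE => /eqP/aP[fi ei].
  by have [_ _] := f_ok i (ltn_ord i) fi; rewrite ei (negbTE ae).
- have prefE x y : pref_count Q x y = #|[set i : 'I_n | (x, y) \in V i]|.
    rewrite /pref_count (count_card_ord set0 _ sQ); apply: eq_card => i.
    by rewrite !inE nthQ.
  (* By the choice of [V], a vote that prefers [e] to [d] without being forced to ranks [e] first,
     hence lies in [X] but not in [Z]. *)
  have le_ed : pref_count Q e d <= K + #|FE|.
    rewrite prefE; apply: leq_trans (leq_add XK (leqnn _)).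
    apply: leq_trans (leq_card_setU _ _); apply/subset_leq_card/subsetP => i.
    rewrite [in X in X -> _]inE => ed_i; have [[[_ anti _] _] _ _ de_i] := VP i.
    rewrite !inE; have [fe|nfe] := boolP ((e, d) \in O i); first by rewrite orbT.
    rewrite andbF orbF; apply: te; apply/eqP; rewrite eq_sym.
    apply/negPn/negP => et; have := anti _ _ ed_i (de_i et nfe).
    by move/eqP; rewrite (negbTE ed).
  have : n <= pref_count Q e d + pref_count Q d e.
    rewrite !prefE -[leqLHS]card_ord; apply: leq_trans (leq_card_setU _ _).
    apply/subset_leq_card/subsetP => i _; rewrite !inE; apply/orP.
    by have [[_ tot] _ _ _] := VP i; apply: tot.
  lia.
Qed.

End Core.

(** * The algorithm on Boolean matrices *)

Definition entry (M : seq (seq bool)) (a b : nat) : bool :=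
  nth false (nth [::] M a) b.

Definition undominated_mx (m : nat) (M : seq (seq bool)) (a : nat) : bool :=
  all (fun b => entry M b a ==> (b == a)) (iota 0 m).

Definition flexible_mx (m d e : nat) (M : seq (seq bool)) : bool :=
  ~~ undominated_mx m M d && ~~ (undominated_mx m M e && entry M e d).

Definition enough_tops_mx (m : nat) (Ms : seq (seq (seq bool))) (d e T K : nat) :
    bool :=
  [&& T <= count (fun M => undominated_mx m M d) Ms,
      T <= count (fun M => undominated_mx m M e) Ms,
      2 * T <= count (fun M => undominated_mx m M d || undominated_mx m M e) Ms,
      2 * (K + count (fun M => entry M e d) Ms) <= size Ms
    & T <= count (fun M => undominated_mx m M e && entry M e d) Ms + K].

Definition slot_ok_mx (m : nat) (Ms : seq (seq (seq bool))) (d e T K i : nat)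
    (s : nat * nat) : bool :=
  [&& s.1 != d, undominated_mx m (nth [::] Ms i) s.1
    & s.2 < (if s.1 == e then K else T)].

(** The list of slots does not depend on [T] and [K]: their limits are imposed by the adjacency, and
    neither exceeds the number of votes when they are tried. *)
Definition assignable_mx (m : nat) (Ms : seq (seq (seq bool))) (d e T K : nat) :
    bool :=
  matchable (slot_ok_mx m Ms d e T K)
    [seq i <- iota 0 (size Ms) | flexible_mx m d e (nth [::] Ms i)]
    [seq (a, k) | a <- iota 0 m, k <- iota 0 (size Ms)].

(** Both parameters can be tried exhaustively, as neither has to exceed the number of votes. *)
Definition spoiled_mx (m : nat) (Ms : seq (seq (seq bool))) (d e : nat) : bool :=
  has (fun T => has (fun K => enough_tops_mx m Ms d e T K &&
                              assignable_mx m Ms d e T K)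
                    (iota 0 (size Ms).+1))
      (iota 0 (size Ms).+1).

(** The number of alternatives is read off as the length of the indicator vector of the
    candidate. *)
Definition necessary_mx (x : seq bool * seq (seq (seq bool))) : bool :=
  all (fun d => nth false x.1 d ||
         all (fun e => (e == d) || ~~ spoiled_mx (size x.1) x.2 d e)
             (iota 0 (size x.1)))
      (iota 0 (size x.1)).

(** * Running time of the matrix algorithm *)

Lemma polytime_entry (G : encType) (M : G -> seq (seq bool)) (a b : G -> nat) :
  polytime M -> polytime a -> polytime b ->
  polytime (fun x => entry (M x) (a x) (b x)).
Proof.
by move=> pM pa pb; apply: polytime_nth pb; apply: polytime_nth pa.
Qed.

Lemma polytime_undominated_mx (G : encType) (m : G -> nat)
    (M : G -> seq (seq bool)) (a : G -> nat) :
  polytime m -> polytime M -> polytime a ->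
  polytime (fun x => undominated_mx (m x) (M x) (a x)).
Proof.
move=> pm pM pa; apply: polytime_all; first exact: polytime_iota0.
have lift (A : encType) (f : G -> A) : polytime f -> polytime (fun y : G * nat => f y.1).
  by move=> pf; apply: polytime_comp (polytime_fst (polytime_id _)) pf.
have p2 : polytime (fun y : G * nat => y.2) by apply/polytime_snd/polytime_id.
by apply: polytime_implb; [apply: polytime_entry|apply: polytime_eqn] => //; apply: lift.
Qed.

Lemma polytime_eq_pair (G : encType) (p q : G -> nat * nat) :
  polytime p -> polytime q -> polytime (fun x => p x == q x).
Proof.
move=> pp pq; apply: eq_polytime (polytime_andb
  (polytime_eqn (polytime_fst pp) (polytime_fst pq))
  (polytime_eqn (polytime_snd pp) (polytime_snd pq))) => x.
by rewrite -xpair_eqE -!surjective_pairing.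
Qed.

(** Applies the closure lemma for the outermost symbol of the function and leaves the goals it does
    not recognise. *)
Ltac polytime_auto :=
  cbv beta;
  lazymatch goal with
  | |- @polytime _ _ (fun x => x) => exact: polytime_id
  | |- @polytime _ _ fst => exact: (polytime_fst (polytime_id _))
  | |- @polytime _ _ snd => exact: (polytime_snd (polytime_id _))
  | |- @polytime _ _ (fun _ => ?c) => exact: polytime_const
  | |- @polytime _ _ (fun x => fst _) => apply: polytime_fst; polytime_auto
  | |- @polytime _ _ (fun x => snd _) => apply: polytime_snd; polytime_auto
  | |- @polytime _ _ (fun x => pair _ _) => apply: polytime_pair; polytime_auto
  | |- @polytime _ _ (fun x => negb _) => apply: polytime_negb; polytime_auto
  | |- @polytime _ _ (fun x => andb _ _) => apply: polytime_andb; polytime_auto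
  | |- @polytime _ _ (fun x => orb _ _) => apply: polytime_orb; polytime_auto
  | |- @polytime _ _ (fun x => implb _ _) => apply: polytime_implb; polytime_auto
  | |- @polytime _ _ (fun x => if _ then _ else _) => apply: polytime_if; polytime_auto
  | |- @polytime _ _ (fun x => S _) => apply: polytime_succn; polytime_auto
  | |- @polytime _ _ (fun x => addn _ _) => apply: polytime_addn; polytime_auto
  | |- @polytime _ _ (fun x => muln _ _) => apply: polytime_muln; polytime_auto
  | |- @polytime _ _ (fun x => leq _ _) => apply: polytime_leq; polytime_auto
  | |- @polytime _ _ (fun x => eq_op _ _) =>
      first [apply: polytime_eqn | apply: polytime_eq_pair]; polytime_auto
  | |- @polytime _ _ (fun x => nilp _) => apply: polytime_nilp; polytime_auto
  | |- @polytime _ _ (fun x => cons _ _) => apply: polytime_cons; polytime_auto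
  | |- @polytime _ _ (fun x => size _) => apply: polytime_size; polytime_auto
  | |- @polytime _ _ (fun x => nth _ _ _) => apply: polytime_nth; polytime_auto
  | |- @polytime _ _ (fun x => head _ _) => apply: polytime_head; polytime_auto
  | |- @polytime _ _ (fun x => iota 0 _) => apply: polytime_iota0; polytime_auto
  | |- @polytime _ _ (fun x => map _ _) => apply: polytime_map; polytime_auto
  | |- @polytime _ _ (fun x => filter _ _) => apply: polytime_filter; polytime_auto
  | |- @polytime _ _ (fun x => has _ _) => apply: polytime_has; polytime_auto
  | |- @polytime _ _ (fun x => all _ _) => apply: polytime_all; polytime_auto
  | |- @polytime _ _ (fun x => count _ _) => apply: polytime_count; polytime_auto
  | |- @polytime _ _ (fun x => flatten _) => apply: polytime_flatten; polytime_auto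
  | |- @polytime _ _ (fun x => entry _ _ _) => apply: polytime_entry; polytime_auto
  | |- @polytime _ _ (fun x => undominated_mx _ _ _) =>
      apply: polytime_undominated_mx; polytime_auto
  | |- _ => first [assumption | match goal with H : polytime _ |- _ =>
      apply: (polytime_comp _ H); polytime_auto end | idtac]
  end.

Definition log_type : Type := seq (nat * (nat * nat)).

Lemma polytime_price (G : encType) (log : G -> log_type) (j : G -> nat * nat) :
  polytime log -> polytime j -> polytime (fun x => price (log x) (j x)).
Proof.
by move=> pl pj; rewrite /price; polytime_auto.
Qed.

(** A nonemptiness test and a comparison with the head replace the option, which avoids encoding it;
    the test makes the default 0 harmless. *)
Lemma polytime_holds (G : encType) (log : G -> log_type) (v : G -> nat)
    (j : G -> nat * nat) :
  polytime log -> polytime v -> polytime j ->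
  polytime (fun x => holds (log x) (v x) (j x)).
Proof.
move=> pl pv pj.
apply: (@eq_polytime _ _ (fun x => ~~ nilp (bids_on (log x) (j x)) &&
    (head 0 (bids_on (log x) (j x)) == v x))) => [x|].
  by rewrite /holds; case: (bids_on _ _).
have pb : polytime (fun x => bids_on (log x) (j x)).
  by rewrite /bids_on; polytime_auto.
by polytime_auto.
Qed.

Lemma polytime_matchable (G : encType) (adj : G -> nat -> nat * nat -> bool)
    (vs : G -> seq nat) (slots : G -> seq (nat * nat)) :
  polytime vs -> polytime slots ->
  polytime (fun y : G * nat * (nat * nat) => adj y.1.1 y.1.2 y.2) ->
  polytime (fun x => matchable (adj x) (vs x) (slots x)).
Proof.
move=> pv ps pa.
have pa' (H : encType) (g : H -> G) (v : H -> nat) (j : H -> nat * nat) :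
    polytime g -> polytime v -> polytime j ->
    polytime (fun z => adj (g z) (v z) (j z)).
  move=> pg pv' pj; apply: (polytime_comp (f := fun z => (g z, v z, j z)) _ pa).
  by polytime_auto.
have pauction : polytime (fun x => auction (adj x) (vs x) (slots x)).
  rewrite /auction /rounds.
  (* A step adds at most one bid to the log, an amount independent of the log. *)
  apply: (@polytime_foldl _ _ _ _ _ (fun x b log => bid (adj x) (slots x) log b)
    (fun y => esize y.2 + 1)).
  - exists 1 => -[x b]; rewrite esize_pair expn1 /=; have := esize_gt0 x; lia.
  - by move=> x b log; rewrite /bid; case: ifP; rewrite ?esize_cons /=; lia.
  - polytime_auto.
  - polytime_auto.
  rewrite /bid /may_bid; polytime_auto.
  - by apply: pa'; polytime_auto.
  - by apply: polytime_holds; polytime_auto.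
  - by apply: polytime_price; polytime_auto.
  - by apply: pa'; polytime_auto.
  - by apply: polytime_price; polytime_auto.
  - by apply: polytime_price; polytime_auto.
by rewrite /matchable; polytime_auto; apply: polytime_holds; polytime_auto.
Qed.

Lemma polytime_necessary_mx : polytime necessary_mx.
Proof.
rewrite /necessary_mx /spoiled_mx /enough_tops_mx; polytime_auto.
apply: polytime_matchable.
- by rewrite /flexible_mx; polytime_auto.
- by polytime_auto.
- by rewrite /slot_ok_mx; polytime_auto.
Qed.

(** * Agreement of matrices with partial orders *)

Lemma enc_seq_map (T U : Type) (f : T -> U) (e : U -> tree) (e' : T -> tree)
    (s : seq T) :
  (forall x, e (f x) = e' x) -> enc_seq e [seq f x | x <- s] = enc_seq e' s.
Proof. by move=> ef; elim: s => //= x s ->; rewrite ef. Qed.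

Definition matrix_of (C : finType) (R : relation C) : seq (seq bool) :=
  [seq [seq (a, b) \in R | b <- enum C] | a <- enum C].

Definition matrix_instance (x : instance) : seq bool * seq (seq (seq bool)) :=
  ([seq a == candidate x | a <- enum (alternatives x)],
   [seq matrix_of R | R <- votes x]).

(** An instance and its matrices have the same encoding, so nothing has to be computed. *)
Lemma polytime_matrix_instance : polytime matrix_instance.
Proof.
apply: (@polytime_recode _ _ _ id); last exact: polytime_id.
move=> x; congr Node; apply/esym/enc_seq_map => // R.
by apply: enc_seq_map => a; apply: enc_seq_map.
Qed.

Section Transfer.
Variables (C : finType) (c : C).
Let m := #|C|.
Let alt (i : nat) : C := nth c (enum C) i.

Lemma alt_inj i j : i < m -> j < m -> alt i = alt j -> i = j.
Proof.
move=> im jm /eqP; rewrite /alt nth_uniq ?enum_uniq -?cardE //.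
by move/eqP.
Qed.

Lemma alt_index (a : C) : index a (enum C) < m /\ alt (index a (enum C)) = a.
Proof.
by rewrite /alt /m cardE index_mem mem_enum nth_index ?mem_enum.
Qed.

Lemma entry_matrix_of (R : relation C) i j : i < m -> j < m ->
  entry (matrix_of R) i j = ((alt i, alt j) \in R).
Proof.
by move=> im jm; rewrite /entry (nth_map c) -?cardE // (nth_map c) -?cardE.
Qed.

Lemma undominated_matrix_of (R : relation C) i : i < m ->
  undominated_mx m (matrix_of R) i = undominated R (alt i).
Proof.
move=> im; apply/allP/undominatedP => h.
  move=> b; have [bm {1}<-] := alt_index b; rewrite -entry_matrix_of // => e.
  have := h (index b (enum C)); rewrite mem_iota bm e => /(_ isT) /eqP <-.
  by rewrite (alt_index b).2.
move=> j; rewrite mem_iota => jm; apply/implyP; rewrite entry_matrix_of //.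
by move/h => /alt_inj => ->.
Qed.

Lemma flexible_matrix_of (R : relation C) i j : i < m -> j < m ->
  flexible_mx m i j (matrix_of R) = flexible (alt i) (alt j) R.
Proof.
by move=> im jm; rewrite /flexible_mx !undominated_matrix_of // entry_matrix_of.
Qed.

Variable P : seq (relation C).
Let Ms := [seq matrix_of R | R <- P].

Lemma enough_tops_matrix_of i j T K : i < m -> j < m ->
  enough_tops_mx m Ms i j T K = enough_tops P (alt i) (alt j) T K.
Proof.
move=> im jm; rewrite /enough_tops_mx /enough_tops !count_map size_map !mul2n.
congr [&& T <= _, T <= _, _ <= _, (K + _).*2 <= _ & T <= _ + K];
  by apply: eq_count => R /=; rewrite ?undominated_matrix_of ?entry_matrix_of.
Qed.

Lemma assignable_matrix_of i j T K : i < m -> j < m ->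
  T <= size P -> K <= size P ->
  assignable_mx m Ms i j T K <-> assignable P (alt i) (alt j) T K.
Proof.
move=> im jm TP KP; rewrite /assignable_mx size_map.
set vs := filter _ _; set slots := flatten _.
have uniq_slots : uniq slots.
  by apply: allpairs_uniq; rewrite ?iota_uniq // => -[a k] [b l] _ _ [-> ->].
have nthM v : v < size P -> nth [::] Ms v = matrix_of (nth set0 P v).
  by move=> vP; rewrite (nth_map set0).
have vsE v : (v \in vs) =
    (v < size P) && flexible (alt i) (alt j) (nth set0 P v).
  rewrite mem_filter mem_iota /= add0n andbC; case: ltnP => //= vP.
  by rewrite nthM // flexible_matrix_of.
have slotsE s : (s \in slots) = (s.1 < m) && (s.2 < size P).
  case: s => a k; apply/allpairsP/andP => [[[b l] /= [+ + [-> ->]]]|[am kP]].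
    by rewrite !mem_iota.
  by exists (a, k); rewrite !mem_iota.
have slot_okE v s : v < size P -> s.1 < m -> slot_ok_mx m Ms i j T K v s =
    [&& alt s.1 != alt i, undominated (nth set0 P v) (alt s.1)
      & s.2 < (if alt s.1 == alt j then K else T)].
  have altE a b : a < m -> b < m -> (a == b) = (alt a == alt b).
    by move=> am bm; apply/eqP/eqP => [->//|]; apply: alt_inj.
  by move=> vP sm; rewrite /slot_ok_mx nthM // undominated_matrix_of // !altE.
split=> [/(@matchableP _ _ _ _ _ uniq_slots (0, 0))[f [f_ok f_inj]]|[f [f_ok f_inj]]].
  exists (fun v => (alt (f v).1, (f v).2)); split=> [v vP flex_v|u v uP vP flex_u flex_v].
    have [] := f_ok v; first by rewrite vsE vP.
    by rewrite slotsE => /andP[sm _]; rewrite slot_okE //= => /and3P[].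
  have uV : u \in vs by rewrite vsE uP.
  have vV : v \in vs by rewrite vsE vP.
  have [+ _] := f_ok u uV; have [+ _] := f_ok v vV.
  rewrite !slotsE => /andP[um _] /andP[vm _] [/alt_inj e1 e2].
  apply: f_inj => //.
  by rewrite [f u]surjective_pairing [f v]surjective_pairing e1 // e2.
apply/(@matchableP _ _ _ _ _ uniq_slots (0, 0)).
exists (fun v => (index (f v).1 (enum C), (f v).2)); split=> [v|u v].
  rewrite vsE => /andP[vP flex_v]; have [fi und_f lt_f] := f_ok v vP flex_v.
  have [am altE] := alt_index (f v).1.
  rewrite slotsE slot_okE /= ?am ?altE ?fi ?und_f ?lt_f //; split=> //.
  (* Both [T] and [K] are at most the number of votes, so the slot is in the list. *)
  by apply: leq_trans lt_f _; case: ifP.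
rewrite !vsE => /andP[uP flex_u] /andP[vP flex_v] [e1 e2].
apply: f_inj => //; rewrite [f u]surjective_pairing [f v]surjective_pairing e2.
by rewrite -(alt_index (f u).1).2 e1 (alt_index (f v).1).2.
Qed.

Lemma spoiled_matrix_of i j : i < m -> j < m -> partial_profile P -> j != i ->
  spoiled_mx m Ms i j <-> spoiled P (alt i) (alt j).
Proof.
move=> im jm P_po ji.
have ji' : alt j != alt i by apply: contra_neq ji; apply: alt_inj.
rewrite /spoiled_mx size_map; split.
  case/hasP=> T; rewrite mem_iota ltnS => TP /hasP[K]; rewrite mem_iota ltnS => KP.
  rewrite enough_tops_matrix_of // => /andP[enough /assignable_matrix_of].
  by move=> /(_ im jm TP KP); apply: assignable_spoiled.
case/(spoiled_assignable ji') => T [K [TP KP enough assign]].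
apply/hasP; exists T; first by rewrite mem_iota ltnS.
apply/hasP; exists K; first by rewrite mem_iota ltnS.
by rewrite enough_tops_matrix_of // enough; apply/assignable_matrix_of.
Qed.

End Transfer.

(** * Correctness and the polynomial-time bound *)

(** As some alternative always wins, it is enough that no [d] other than [c] ever does; its opponent
    [e] may be [c] or a third alternative. Having [d] differ from [c] supplies the two alternatives
    that [runoff_winnerP] asks for. *)
Lemma necessary_unique_winnerP (C : finType) (P : seq (relation C)) (c : C) :
  partial_profile P ->
  necessary_unique_winner (@plurality_runoff C) P c <->
  forall d e, d != c -> e != d -> ~ spoiled P d e.
Proof.
move=> P_po; split=> [nec d e dc ed [Q [Q_lin QP tops pref]]|unspoiled Q Q_lin QP].
  have C2 : #|C| > 1.
    by rewrite (cardD1 c) (cardD1 d) !inE dc.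
  have : d \in plurality_runoff Q by apply/runoff_winnerP => //; exists e.
  by rewrite (nec Q Q_lin QP) inE (negbTE dc).
have only_c d : d \in plurality_runoff Q -> d = c.
  move=> dQ; apply/eqP/negPn/negP => dc.
  have C2 : #|C| > 1.
    by rewrite (cardD1 c) (cardD1 d) !inE dc.
  have [e [ed tops pref]] := elimT (runoff_winnerP Q d C2) dQ.
  by apply: (unspoiled d e) => //; exists Q.
have [w wQ] := runoff_nonempty Q c.
apply/setP => d; rewrite inE; apply/idP/eqP => [/only_c//|->].
by rewrite -(only_c w wQ).
Qed.

Lemma necessary_mxP (x : instance) :
  necessary_mx (matrix_instance x) <->
  necessary_unique_winner (@plurality_runoff (alternatives x)) (votes x)
    (candidate x).
Proof.
rewrite necessary_unique_winnerP; last exact: votesP.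
set C := alternatives x; set c := candidate x.
have sz : size (matrix_instance x).1 = #|C| by rewrite size_map -cardE.
pose alt i := nth c (enum C) i.
have candE i : i < #|C| -> nth false (matrix_instance x).1 i = (alt i == c).
  by move=> im; rewrite (nth_map c) -?cardE.
rewrite /necessary_mx sz; split=> [/allP nec d e dc ed sp|unspoiled].
  have [dm dE] := alt_index c d; have [em eE] := alt_index c e.
  have := nec (index d (enum C)); rewrite mem_iota dm => /(_ isT).
  rewrite candE // /alt dE (negbTE dc) /= => /allP /(_ (index e (enum C))).
  have ed' : index e (enum C) != index d (enum C).
    by apply: contra_neq ed => ed; rewrite -eE -dE ed.
  rewrite mem_iota em (negbTE ed') => /(_ isT) /= /negP; apply.
  by apply/(spoiled_matrix_of c) => //; [exact: votesP|rewrite dE eE].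
apply/allP => i; rewrite mem_iota /= add0n => im; rewrite candE //.
have [//|ic] := eqVneq; apply/allP => j; rewrite mem_iota /= add0n => jm.
have [//|ji] := eqVneq; apply/negP => /(spoiled_matrix_of c) sp.
apply: (unspoiled (alt i) (alt j)) => //.
  by apply: contra_neq ji; apply: alt_inj.
by apply: sp => //; apply: votesP.
Qed.

Theorem proposition7 :
  polytime_decidable enc_instance
    (fun x : instance =>
       necessary_unique_winner (@plurality_runoff (alternatives x))
         (votes x) (candidate x)).
Proof.
have [p [N [T [[k bT] _ run]]]] :=
  polytime_comp polytime_matrix_instance polytime_necessary_mx.
(* This polynomial takes the value [n.+1 ^ k] at a size [n], the form of bound used in
   [poly_bounded]. *)
exists p, (('X + 1) ^+ k)%R => x.
have [t [s [ex s0 _ le_t]]] := run (init_store (enc_instance x)) x erefl.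
exists t, s, (necessary_mx (matrix_instance x)); split=> //.
  apply: leq_trans le_t _; apply: leq_trans (bT x) _.
  by rewrite horner_exp hornerD hornerX hornerC -addn1; apply: leqnn.
exact: necessary_mxP.
Qed.
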